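(* For every integer $t$ with $1\leq t\leq 6$ we have $\frac{t}{6}\Lambda^{(3)}\subseteq\Pi^{(3)}_{\mathrm{vvv},\infty}$, where $\frac{t}{6}\Lambda^{(3)}=\{\frac{t}{6}\Lambda_F : F\text{ is a }3\text{-graph}\}$. That is, for every $3$-graph $F$ with Lagrangian $\Lambda_F$ there is a family $\mathcal{F}$ of $3$-graphs with $\pi_{\mathrm{vvv}}(\mathcal{F})=\frac{t}{6}\Lambda_F$.
   Context: A $3$-graph $H=(V,E)$ consists of a finite vertex set $V$ and an edge set $E\subseteq V^{(3)}$, where $U^{(k)}=\{e\subseteq U : |e|=k\}$ for a set $U$. A family of $3$-graphs is a (possibly infinite) set of $3$-graphs; $H$ is $\mathcal{F}$-free if it contains no member of $\mathcal{F}$ as a (not necessarily induced) subhypergraph. For $d\in[0,1]$ and $\eta>0$, a $3$-graph $H=(V,E)$ is uniformly $(d,\eta)$-dense if $|U^{(3)}\cap E|\geq d\binom{|U|}{3}-\eta|V|^3$ for every $U\subseteq V$. For a family $\mathcal{F}$ of $3$-graphs, the uniform Turán density $\pi_{\mathrm{vvv}}(\mathcal{F})$ is the supremum of all $d\in[0,1]$ such that for every $\eta>0$ and every $n\in\mathbb{N}$ there is an $\mathcal{F}$-free, uniformly $(d,\eta)$-dense $3$-graph $H$ with $|V(H)|\geq n$. Set $\Pi^{(3)}_{\mathrm{vvv},\infty}=\{\pi_{\mathrm{vvv}}(\mathcal{F}) : \mathcal{F}\text{ is a family of }3\text{-graphs}\}$. Let $\mathbb{S}_r=\{(x_1,\dots,x_r)\in[0,1]^r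 : x_1+\dots+x_r=1\}$. For a $3$-graph $F=(V,E)$ on $r$ vertices, with $V$ identified with $[r]=\{1,\dots,r\}$, the Lagrange polynomial is $\lambda_F(x_1,\dots,x_r)=3!\sum_{\{i_1,i_2,i_3\}\in E}x_{i_1}x_{i_2}x_{i_3}$ and the Lagrangian is $\Lambda_F=\max_{\mathbf{x}\in\mathbb{S}_r}\lambda_F(\mathbf{x})$. Set $\Lambda^{(3)}=\{\Lambda_F : F\text{ is a }3\text{-graph}\}$. *)

(* Defs.v *)
From mathcomp Require Import all_boot all_order all_algebra.
From mathcomp Require Import all_classical all_reals all_analysis.

Set Implicit Arguments.
Unset Strict Implicit.
Unset Printing Implicit Defensive.

Import Order.TTheory GRing.Theory Num.Theory.
Import numFieldNormedType.Exports.

Local Open Scope classical_set_scope.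
Local Open Scope ring_scope.

Definition ksubsets (V : finType) (k : nat) (U : {set V}) : {set {set V}} :=
  [set e : {set V} | (e \subset U) && (#|e| == k)]%SET.

Record graph3 : Type := Graph3 {
  vert : finType;
  edges : {set {set vert}};
  edges_sub : edges \subset ksubsets 3 [set: vert]%SET
}.

(* [H] has a (not necessarily induced) subhypergraph isomorphic to [F]. *)
Definition contains (H F : graph3) : Prop :=
  exists2 f : vert F -> vert H, injective f &
    forall e : {set vert F}, e \in edges F -> (f @: e)%SET \in edges H.

(* [set] cannot hold [graph3], whose universe is too large. *)
Definition family : Type := graph3 -> Prop.

Definition free (FF : family) (H : graph3) : Prop :=
  forall F : graph3, FF F -> ~ contains H F.

Section UniformTuran.
Variable R : realType.

Definition uniformly_dense (d eta : R) (H : graph3) : Prop :=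
  forall U : {set vert H},
    d * 'C(#|U|, 3)%:R - eta * #|vert H|%:R ^+ 3
      <= #|(ksubsets 3 U :&: edges H)%SET|%:R.

(* If [FF] has an edgeless member, then no [d] qualifies, and the value is
   [sup set0 = 0], the supremum of the empty set in [0, 1]. *)
Definition pi_vvv (FF : family) : R :=
  sup [set d : R | 0 <= d <= 1 /\
    forall (eta : R) (n : nat), 0 < eta ->
      exists H : graph3,
        [/\ free FF H, uniformly_dense d eta H & (n <= #|vert H|)%N]].

Definition Pi_vvv_infty : set R :=
  [set p | exists FF : family, p = pi_vvv FF].

(* The weights are indexed by the vertices themselves instead of by [r]. *)
Definition simplex (V : finType) : set (V -> R) :=
  [set x | (forall i, 0 <= x i <= 1) /\ \sum_i x i = 1].

Definition lagrange_poly (F : graph3) (x : vert F -> R) : R :=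
  3`!%:R * \sum_(e in edges F) \prod_(i in e) x i.

Arguments lagrange_poly : clear implicits.

(* The supremum is attained as soon as [F] has a vertex: see [lagrangian_max].
   Without vertices the simplex is empty and the value is [sup set0 = 0],
   which is also the Lagrangian of the one-vertex 3-graph. *)
Definition lagrangian (F : graph3) : R :=
  sup [set lagrange_poly F x | x in @simplex (vert F)].

Definition Lambda3 : set R := [set l | exists F : graph3, l = lagrangian F].

Lemma simplex_nonempty (V : finType) : (0 < #|V|)%N -> @simplex V !=set0.
Proof.
case/card_gt0P => v _; exists (fun i => (i == v)%:R); split.
  by move=> i; case: (i == v); rewrite ?lexx ler01.
by rewrite (bigD1 v) //= eqxx big1 ?addr0 // => i /negbTE ->.
Qed.

Let addR_continuous : continuous (fun z : R * R => z.1 + z.2).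
Proof. by move=> z; apply: cvgD; [exact: cvg_fst | exact: cvg_snd]. Qed.

Let mulR_continuous : continuous (fun z : R * R => z.1 * z.2).
Proof. by move=> z; apply: cvgM; [exact: cvg_fst | exact: cvg_snd]. Qed.

Lemma simplex_compact (V : finType) :
  compact (@simplex V : set (prod_topology (fun _ : V => R))).
Proof.
pose T : topologicalType := prod_topology (fun _ : V => R).
have cp i : continuous (fun x : T => x i).
  exact: (@proj_continuous V (fun=> R) i).
have cs : continuous (fun x : T => \sum_i x i).
  by apply: (@continuous_big R V +%R 0 xpredT addR_continuous T _
    (fun i x => x i)) => i _; exact: cp.
have -> : @simplex V = [set x : T | forall i, `[0, 1]%classic (x i)] `&`
    (fun x : T => \sum_i x i) @^-1` [set 1 : R].
  apply/seteqP; split=> x /= [xI xS]; split=> // i; move: (xI i);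
    by rewrite in_itv.
apply: compact_closedI.
  by apply: (@tychonoff V (fun=> R) (fun=> `[0, 1]%classic)) => i; exact: segment_compact.
apply: (@preimage_closed T R (fun x : T => \sum_i x i) [set 1 : R]).
  by move=> x _; exact: cs.
exact: closed_eq.
Qed.

Lemma lagrangian_max (F : graph3) : (0 < #|vert F|)%N ->
  exists2 x, simplex x &
    lagrange_poly F x = lagrangian F /\
    forall y, simplex y -> lagrange_poly F y <= lagrangian F.
Proof.
move=> F0; pose T : topologicalType := prod_topology (fun _ : vert F => R).
have cl : continuous (fun x : T => lagrange_poly F x).
  have cp e : continuous (fun x : T => \prod_(i in e) x i).
    apply: (@continuous_big R (vert F) *%R 1 (mem e) mulR_continuous T _
      (fun i x => x i)) => i _.
    exact: (@proj_continuous (vert F) (fun=> R) i).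
  pose S (x : T) : R := \sum_(e in edges F) \prod_(i in e) x i.
  have cS : continuous S.
    by apply: (@continuous_big R _ +%R 0 (mem (edges F)) addR_continuous
      T _ (fun e x => \prod_(i in e) x i)) => e _; exact: cp.
  move=> x; exact: (@cvgM R T (nbhs x) _ (fun=> 3`!%:R) S _ _
    (cvg_cst _) (cS x)).
have [x xS xM] := @compact_EVT_max T R _ _ (simplex_nonempty F0)
  (@simplex_compact (vert F)) (continuous_subspaceT cl).
have {}xS : simplex x by exact: set_mem.
have xub : ubound [set lagrange_poly F y | y in @simplex (vert F)]
    (lagrange_poly F x).
  by move=> _ [y yS <-]; apply: xM; exact: mem_set.
have -> : lagrangian F = lagrange_poly F x.
  apply/eqP; rewrite eq_le; apply/andP; split.
    by apply: ge_sup => //; exists (lagrange_poly F x), x.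
  by apply: ub_le_sup; [exists (lagrange_poly F x) | exists x].
by exists x => //; split=> // y yS; apply: xub; exists y.
Qed.

End UniformTuran.

Arguments pi_vvv : clear implicits.
Arguments Pi_vvv_infty : clear implicits.
Arguments simplex : clear implicits.
Arguments lagrangian : clear implicits.
Arguments Lambda3 : clear implicits.
Arguments lagrange_poly {R} F x.

(* Main.v *)
Require Import Defs.
From mathcomp Require Import all_boot all_order all_algebra.
From mathcomp Require Import all_classical all_reals all_analysis.
From mathcomp Require Import ring lra zify.

(** Order the vertices, colour the pairs with a finite set [C], and let [T] be a
set of colour triples (a palette). A 3-graph is [T]-colourable if each of its
edges [x < y < z] has [(col x y, col x z, col y z)] in [T]. The 3-graphs that
are not [T]-colourable form a family whose density is the maximum over the
simplex of the palette polynomial, the sum of [x_a x_b x_c] over [(a, b, c)] in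
[T]. If [C] is the vertex set of [F] and [T] contains [t] of the six orderings
of each edge of [F], this polynomial is [t / 6] times the Lagrange polynomial.

Lower bound: colour the pairs independently with the maximising weights. The
expected 4-cycle count of each centred colour class is small, so some colouring
has all colour classes quasirandom in cut norm, and a counting lemma gives the
right number of edges inside every vertex set.

Upper bound: in a [T]-colourable 3-graph, cut the order into intervals, take
subclusters that are pairwise regular for all colours (a maximiser of size times
the exponential of the energy), and pass by Ramsey's theorem to many clusters
with almost the same colour densities [d]. The counting lemma bounds the edge
density on their union by the palette polynomial at [d]. *)

Set Implicit Arguments.
Unset Strict Implicit.
Unset Printing Implicit Defensive.
Import Order.TTheory GRing.Theory Num.Theory.
Local Open Scope ring_scope.

(** * Cut norm and triangle counting *)

Section CutNorm.
Variable R : realType.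

Definition unit_valued (V : Type) (u : V -> R) := forall x, 0 <= u x <= 1.

Lemma unit_valuedM (V : Type) (u v : V -> R) :
  unit_valued u -> unit_valued v -> unit_valued (fun x => u x * v x).
Proof.
move=> uI vI x; have /andP[u0 u1] := uI x; have /andP[v0 v1] := vI x.
by rewrite mulr_ge0 //= mulr_ile1.
Qed.

Lemma unit_valued_bool (V : Type) (p : V -> bool) :
  unit_valued (fun x => (p x)%:R).
Proof. by move=> x; rewrite ler0n lern1 leq_b1. Qed.

(** The left side is largest when [u] is the indicator of the set where [h] is nonnegative. *)
Lemma linear_le_of_sets (V : finType) (h : V -> R) (k : R) :
  (forall A : {set V}, \sum_(x in A) h x <= k) ->
  forall u, unit_valued u -> \sum_x u x * h x <= k.
Proof.
move=> hk u uI; apply: le_trans (hk [set x | 0 <= h x]%SET).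
rewrite [leRHS]big_mkcond /=; apply: ler_sum => x _; rewrite inE.
have /andP[u0 u1] := uI x; case: ifPn => [h0|]; first by nra.
by rewrite -ltNge => h0; nra.
Qed.

Lemma bilinear_le_of_sets (V : finType) (F : V -> V -> R) (k : R) :
  (forall A B : {set V}, \sum_(x in A) \sum_(y in B) F x y <= k) ->
  forall u v, unit_valued u -> unit_valued v ->
    \sum_x \sum_y u x * v y * F x y <= k.
Proof.
move=> Fk u v uI vI.
under eq_bigr => x _.
  rewrite (eq_bigr (fun y => u x * (v y * F x y))); last by move=> y _; rewrite mulrA.
  rewrite -mulr_sumr; over.
apply: linear_le_of_sets => // A; rewrite exchange_big /=.
under eq_bigr do rewrite -mulr_sumr.
apply: linear_le_of_sets => // B; rewrite exchange_big /=; exact: Fk.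
Qed.

(** A weighted cut norm bound, with test functions in place of sets: the counting lemma tests
    against slices of functions that need not be 0/1-valued. *)
Definition cut_le (V : finType) (k : R) (w1 w2 : V -> R) (F : V -> V -> R) :=
  forall u v, unit_valued u -> unit_valued v ->
    `|\sum_x \sum_y w1 x * w2 y * (u x * v y * F x y)| <= k.

Lemma cut_le_of_sets (V : finType) (k : R) (w1 w2 : V -> R) (F : V -> V -> R) :
  (forall A B : {set V}, `|\sum_(x in A) \sum_(y in B) w1 x * w2 y * F x y| <= k) ->
  cut_le k w1 w2 F.
Proof.
move=> Fk u v uI vI.
have E : \sum_x \sum_y w1 x * w2 y * (u x * v y * F x y) =
   \sum_x \sum_y u x * v y * (w1 x * w2 y * F x y).
  by apply: eq_bigr => x _; apply: eq_bigr => y _; ring.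
rewrite E ler_norml; apply/andP; split; last first.
  by apply: bilinear_le_of_sets => // A B; have := Fk A B; rewrite ler_norml => /andP[].
rewrite lerNl -sumrN; under eq_bigr do rewrite -sumrN.
under eq_bigr do under eq_bigr do rewrite -mulrN.
apply: (bilinear_le_of_sets (F := fun x y => - (w1 x * w2 y * F x y))) => // A B.
have := Fk A B; rewrite ler_norml => /andP[+ _]; rewrite lerNl; apply: le_trans.
by rewrite -sumrN; apply: ler_sum => x _; rewrite -sumrN.
Qed.

(* Telescoping: in [F1 G2 G3 + H1 F2 G3 + H1 H2 F3] with [Fi = Gi - Hi], fixing
   the vertex missed by [Fi] turns the two other factors into test functions. *)
Lemma triangle_counting (V : finType) (k : R) (w1 w2 w3 : V -> R)
    (G1 G2 G3 H1 H2 H3 : V -> V -> R) :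
  (forall x, 0 <= w1 x) -> (forall x, 0 <= w2 x) -> (forall x, 0 <= w3 x) ->
  (forall x, unit_valued (G2 x)) -> (forall x, unit_valued (G3 x)) ->
  (forall x, unit_valued (H1 x)) -> (forall x, unit_valued (H2 x)) ->
  cut_le k w1 w2 (fun x y => G1 x y - H1 x y) ->
  cut_le k w1 w3 (fun x y => G2 x y - H2 x y) ->
  cut_le k w2 w3 (fun x y => G3 x y - H3 x y) ->
  `|\sum_x \sum_y \sum_z w1 x * w2 y * w3 z *
      (G1 x y * G2 x z * G3 y z - H1 x y * H2 x z * H3 y z)|
    <= k * (\sum_x w1 x + \sum_x w2 x + \sum_x w3 x).
Proof.
move=> w10 w20 w30 G2I G3I H1I H2I C1 C2 C3.
have -> : \sum_x \sum_y \sum_z w1 x * w2 y * w3 z *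
      (G1 x y * G2 x z * G3 y z - H1 x y * H2 x z * H3 y z) =
  \sum_z w3 z * (\sum_x \sum_y w1 x * w2 y * (G2 x z * G3 y z * (G1 x y - H1 x y)))
  + \sum_y w2 y * (\sum_x \sum_z w1 x * w3 z * (H1 x y * G3 y z * (G2 x z - H2 x z)))
  + \sum_x w1 x * (\sum_y \sum_z w2 y * w3 z * (H1 x y * H2 x z * (G3 y z - H3 y z))).
  rewrite [X in X + _ + _](_ : _ = \sum_x \sum_y \sum_z
      w3 z * (w1 x * w2 y * (G2 x z * G3 y z * (G1 x y - H1 x y)))); last first.
    under eq_bigr => z _.
      rewrite mulr_sumr; under eq_bigr do rewrite mulr_sumr; over.
    by rewrite exchange_big; apply: eq_bigr => x _; rewrite exchange_big.
  rewrite [X in _ + X + _](_ : _ = \sum_x \sum_y \sum_z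
      w2 y * (w1 x * w3 z * (H1 x y * G3 y z * (G2 x z - H2 x z)))); last first.
    under eq_bigr => z _.
      rewrite mulr_sumr; under eq_bigr do rewrite mulr_sumr; over.
    by rewrite exchange_big.
  rewrite -!big_split; apply: eq_bigr => x _ /=; rewrite mulr_sumr -!big_split.
  apply: eq_bigr => y _ /=; rewrite mulr_sumr -!big_split.
  by apply: eq_bigr => z _ /=; ring.
have aux (w : V -> R) (f : V -> R) : (forall x, 0 <= w x) ->
    (forall x, `|f x| <= k) -> `|\sum_x w x * f x| <= k * \sum_x w x.
  move=> w0 fk; apply: le_trans (ler_norm_sum _ _ _) _.
  rewrite mulr_sumr; apply: ler_sum => x _.
  by rewrite normrM (ger0_norm (w0 x)) mulrC ler_wpM2r.
rewrite [leRHS](_ : _ = k * \sum_x w3 x + k * \sum_x w2 x + k * \sum_x w1 x); last by ring.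
apply: le_trans (ler_normD _ _) _; apply: lerD; last first.
  by apply: aux => // x; apply: C3 => z; [exact: H1I | exact: H2I].
apply: le_trans (ler_normD _ _) _; apply: lerD.
  by apply: aux => // z; apply: C1 => x; [exact: G2I | exact: G3I].
by apply: aux => // y; apply: C2 => z; [exact: H1I | exact: G3I].
Qed.

End CutNorm.

(** * Multiaffine polynomials on the cube *)

Section Multiaffine.
Variable R : realType.

Definition set_poly (V : finType) (c : {set V} -> R) (w : V -> R) : R :=
  \sum_(e : {set V}) c e * \prod_(i in e) w i.

Lemma set_poly_affine (V : finType) (c : {set V} -> R) (w : V -> R) (v : V) :
  set_poly c w = w v * set_poly c (fun x => if x == v then 1 else w x) +
    (1 - w v) * set_poly c (fun x => if x == v then 0 else w x).
Proof.
rewrite /set_poly !mulr_sumr -big_split; apply: eq_bigr => e _ /=.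
have [ve|ve] := boolP (v \in e); last first.
  have E y : \prod_(i in e) (if i == v then y else w i) = \prod_(i in e) w i.
    apply: eq_bigr => i ie; rewrite ifN //.
    by apply: contraNneq ve => <-.
  by rewrite !E; ring.
have E y : \prod_(i in e) (if i == v then y else w i) =
    y * \prod_(i in e | i != v) w i.
  rewrite (bigD1 v) //= eqxx; congr (_ * _); apply: eq_bigr => i /andP[_ /negbTE ->] //.
by rewrite !E (bigD1 v) //=; ring.
Qed.

(** The polynomial is affine in each coordinate, so a fractional coordinate can be rounded to [0] or
    [1] without increasing the value. The induction is on the number of fractional coordinates. *)
Lemma set_poly_min_at_sets (V : finType) (c : {set V} -> R) (w : V -> R) :
  unit_valued w ->
  exists U : {set V}, set_poly c (fun x => (x \in U)%:R) <= set_poly c w.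
Proof.
have [n] := ubnP #|[set x | (w x != 0) && (w x != 1)]|.
elim: n w => // n IH w wn wI.
case: (pickP (fun x => (w x != 0) && (w x != 1))) => [v vw|w01].
  have /andP[v0 v1] := wI v.
  have key (y : R) : (y == 0) || (y == 1) ->
      exists U : {set V}, set_poly c (fun x => (x \in U)%:R) <=
        set_poly c (fun x => if x == v then y else w x).
    move=> y01; apply: IH.
      rewrite ltnS in wn; apply: leq_trans wn; apply/proper_card/properP; split.
        apply/fintype.subsetP => x; rewrite !inE; case: ifP => // _.
        by move: y01; case: (y == 0); case: (y == 1).
      exists v; rewrite inE ?eqxx //.
      by move: y01; case: (y == 0); case: (y == 1).
    move=> x; case: ifP => // _; move: y01 => /orP[]/eqP ->; rewrite ?lexx ler01 //.
  have [|U1 h1] := key 1; first by rewrite eqxx orbT.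
  have [|U0 h0] := key 0; first by rewrite eqxx.
  rewrite (set_poly_affine c w v).
  have [le10|/ltW le01] := leP (set_poly c (fun x => (x \in U1)%:R))
      (set_poly c (fun x => (x \in U0)%:R)).
    by exists U1; nra.
  by exists U0; nra.
exists [set x | w x == 1]%SET; rewrite /set_poly; apply: ler_sum => e _.
rewrite le_eqVlt; apply/orP; left; apply/eqP; congr (_ * _).
apply: eq_bigr => i _;rewrite inE.
have /negbT := w01 i; rewrite negb_and !negbK => /orP[]/eqP ->; rewrite ?eqxx //.
by rewrite eq_sym oner_eq0.
Qed.

End Multiaffine.

(** * Quasirandom colourings *)

Section RandomColoring.
Variable R : realType.

Lemma sum_eqb (I : finType) (i : I) : \sum_j (i == j)%:R = 1 :> R.
Proof.
by rewrite (bigD1 i) //= eqxx big1 ?addr0 // => j; rewrite eq_sym => /negbTE ->.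
Qed.

(** Cauchy-Schwarz, from the nonnegativity of the sum of all [(a i - a j) ^+ 2]. *)
Lemma sqr_sum_le (I : finType) (a : I -> R) :
  (\sum_i a i) ^+ 2 <= #|I|%:R * \sum_i a i ^+ 2.
Proof.
have h : 0 <= \sum_i \sum_j (a i - a j) ^+ 2.
  by apply: sumr_ge0 => i _; apply: sumr_ge0 => j _; exact: sqr_ge0.
have E : \sum_i \sum_j (a i - a j) ^+ 2 =
    2 * (#|I|%:R * \sum_i a i ^+ 2 - (\sum_i a i) ^+ 2).
  pose n : R := #|I|%:R; pose S := \sum_i a i; pose Q := \sum_i a i ^+ 2.
  have c (r : R) : \sum_(i : I) r = n * r by rewrite sumr_const mulr_natl.
  transitivity (\sum_i (n * a i ^+ 2 + Q - 2 * S * a i)).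
    apply: eq_bigr => i _.
    rewrite (eq_bigr (fun j => a i ^+ 2 + a j ^+ 2 - 2 * a i * a j)); last by move=> j _; ring.
    by rewrite sumrB big_split /= c -[X in _ - X]mulr_sumr -/S -/Q; ring.
  by rewrite sumrB big_split /= c -[X in _ - X]mulr_sumr
    -[X in X + _ - _]mulr_sumr -/S -/Q -/n; ring.
by move: h; rewrite E; lra.
Qed.

Lemma exists_le_mean (I : finType) (P f : I -> R) (B : R) :
  (forall i, 0 <= P i) -> \sum_i P i = 1 -> \sum_i P i * f i <= B ->
  exists i, f i <= B.
Proof.
move=> P0 P1 Pf; have [/existsP[i]|] := boolP [exists i, f i <= B]; first by exists i.
move=> /existsPn fB; exfalso.
have h i : 0 <= P i * (f i - B).
  by rewrite mulr_ge0 // subr_ge0; move: (fB i); rewrite -ltNge => /ltW.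
have /eqP : \sum_i P i * (f i - B) == 0.
  rewrite eq_le sumr_ge0 // andbT; under eq_bigr do rewrite mulrBr.
  by rewrite sumrB -mulr_suml P1 mul1r subr_le0.
move=> /psumr_eq0P z; move: (oner_eq0 R); rewrite -P1 big1 ?eqxx // => i _.
have /eqP : P i * (f i - B) = 0 by apply: z.
rewrite mulf_eq0 subr_eq0 => /orP[/eqP //|/eqP fi].
by move: (fB i); rewrite fi lexx.
Qed.

(** Two applications of Cauchy-Schwarz remove first [u] and then [v]; the right side carries the
    weighted count of 4-cycles of [F]. *)
Lemma cut_le_C4 (V : finType) (F : V -> V -> R) (u v : V -> R) :
  unit_valued u -> unit_valued v ->
  (\sum_x \sum_y u x * v y * F x y) ^+ 4 <=
  #|V|%:R ^+ 4 * \sum_y \sum_y' (\sum_x F x y * F x y') ^+ 2.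
Proof.
move=> uI vI; set n := #|V|%:R; have n0 : 0 <= n by exact: ler0n.
set S := (X in X ^+ 4); pose Q := \sum_y \sum_y' v y * v y' * \sum_x F x y * F x y'.
have SQ : S ^+ 2 <= n * Q.
  have -> : S = \sum_x u x * \sum_y v y * F x y.
    by apply: eq_bigr => x _; rewrite mulr_sumr; apply: eq_bigr => y _; rewrite mulrA.
  apply: le_trans (sqr_sum_le _) _; rewrite ler_wpM2l //.
  rewrite [leRHS](_ : _ = \sum_x (\sum_y v y * F x y) ^+ 2); last first.
    rewrite /Q; under eq_bigr do (under eq_bigr do rewrite mulr_sumr).
    under [RHS]eq_bigr => x _.
      rewrite expr2 mulr_suml; under eq_bigr do rewrite mulr_sumr; over.
    rewrite [RHS]exchange_big; apply: eq_bigr => y _.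
    rewrite [RHS]exchange_big; apply: eq_bigr => y' _.
    by apply: eq_bigr => x _; ring.
  apply: ler_sum => x _; rewrite exprMn ler_piMl ?sqr_ge0 //.
  by have /andP[? ?] := uI x; rewrite expr_le1.
have QD : Q ^+ 2 <= n ^+ 2 * \sum_y \sum_y' (\sum_x F x y * F x y') ^+ 2.
  rewrite /Q pair_bigA; apply: le_trans (sqr_sum_le _) _ => /=.
  rewrite card_prod natrM -expr2 ler_wpM2l ?sqr_ge0 // pair_bigA /=.
  apply: ler_sum => -[y y'] _ /=; rewrite exprMn ler_piMl ?sqr_ge0 //.
  have /andP[? ?] := vI y; have /andP[? ?] := vI y'.
  by rewrite expr_le1 ?mulr_ge0 // mulr_ile1.
have -> : S ^+ 4 = (S ^+ 2) ^+ 2 by ring.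
apply: le_trans (_ : (n * Q) ^+ 2 <= _).
  by rewrite ler_sqr ?nnegrE ?sqr_ge0 //; apply: le_trans SQ; exact: sqr_ge0.
rewrite exprMn [n ^+ 4](_ : _ = n ^+ 2 * n ^+ 2); last by ring.
by rewrite -[leRHS]mulrA ler_wpM2l ?sqr_ge0.
Qed.

Variables (V C : finType) (x : C -> R).
Hypothesis x0 : forall c, 0 <= x c.
Hypothesis x1 : \sum_c x c = 1.

(** The probability of [phi] when the pairs get independent colours with law [x]. *)
Let pr (phi : {ffun V * V -> C}) : R := \prod_p x (phi p).

Let pr_ge0 phi : 0 <= pr phi.
Proof. exact: prodr_ge0. Qed.

Let pr_sum1 : \sum_phi pr phi = 1.
Proof. by rewrite -(bigA_distr_bigA (fun _ c => x c)) big1. Qed.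

Let dev a (phi : {ffun V * V -> C}) p : R := (phi p == a)%:R - x a.

(** By independence the expectation factors over the distinct pairs, and the factor of a listed pair
    is [0]. *)
Lemma dev_mean0 a (s : seq (V * V)) : uniq s -> s != [::] ->
  \sum_phi pr phi * \prod_(p <- s) dev a phi p = 0.
Proof.
case: s => // p0 s us _; set s' := p0 :: s.
pose h p c := x c * if p \in s' then (c == a)%:R - x a else 1.
transitivity (\sum_(phi : {ffun V * V -> C}) \prod_p h p (phi p)).
  apply: eq_bigr => phi _; rewrite /h big_split; congr (_ * _).
  by rewrite big_uniq //= [in LHS]big_mkcond.
rewrite -bigA_distr_bigA (bigD1 p0) //= /h mem_head.
have -> : \sum_c x c * ((c == a)%:R - x a) = 0; last by rewrite mul0r.
under eq_bigr do rewrite mulrBr.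
rewrite sumrB -mulr_suml x1 mul1r (bigD1 a) //= eqxx mulr1 big1 ?addr0 ?subrr //.
by move=> c /negbTE ->; rewrite mulr0.
Qed.

Lemma dev_le1 a phi p : `|dev a phi p| <= 1.
Proof.
have xa : x a <= 1 by rewrite -x1 (bigD1 a) //= lerDl sumr_ge0.
have := x0 a; rewrite /dev ler_norml; case: (_ == _) => /=; lra.
Qed.

(** The first-moment method is applied to [D a phi], the 4-cycle count of the deviation of colour
    [a]. The mask [s] serves to restrict to increasing pairs. *)
Lemma quasirandom_coloring (s : V -> V -> R) (k : R) :
  (forall y, unit_valued (s y)) -> 0 < k -> 2 * #|C|%:R <= k ^+ 4 * #|V|%:R ->
  exists col : V -> V -> C, forall a u v, unit_valued u -> unit_valued v ->
    `|\sum_y \sum_z u y * v z * (s y z * ((col y z == a)%:R - x a))| <=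
      k * #|V|%:R ^+ 2.
Proof.
move=> sI k0 hk; set n := #|V|%:R; have n0 : 0 <= n by exact: ler0n.
pose F a phi (y z : V) : R := s y z * dev a phi (y, z).
pose D a phi := \sum_z \sum_z' (\sum_y F a phi y z * F a phi y z') ^+ 2.
have D0 a phi : 0 <= D a phi.
  by apply: sumr_ge0 => z _; apply: sumr_ge0 => z' _; exact: sqr_ge0.
have mD a : \sum_phi pr phi * D a phi <= 2 * n ^+ 3.
  have E : \sum_phi pr phi * D a phi = \sum_z \sum_z' \sum_y \sum_y'
      \sum_phi pr phi * (F a phi y z * F a phi y z' * (F a phi y' z * F a phi y' z')).
    transitivity (\sum_phi \sum_z \sum_z' \sum_y \sum_y'
      pr phi * (F a phi y z * F a phi y z' * (F a phi y' z * F a phi y' z'))).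
      apply: eq_bigr => phi _; rewrite /D mulr_sumr; apply: eq_bigr => z _.
      rewrite mulr_sumr; apply: eq_bigr => z' _; rewrite expr2 mulr_suml mulr_sumr.
      by apply: eq_bigr => y _; rewrite !mulr_sumr.
    rewrite exchange_big; apply: eq_bigr => z _.
    rewrite exchange_big; apply: eq_bigr => z' _.
    rewrite exchange_big; apply: eq_bigr => y _.
    by rewrite exchange_big.
  have B z z' y y' : \sum_phi pr phi *
        (F a phi y z * F a phi y z' * (F a phi y' z * F a phi y' z')) <=
      (z == z')%:R + (y == y')%:R.
    have S phi : F a phi y z * F a phi y z' * (F a phi y' z * F a phi y' z') =
       (s y z * s y z' * (s y' z * s y' z')) *
       \prod_(p <- [:: (y, z); (y, z'); (y', z); (y', z')]) dev a phi p.
      by rewrite !big_cons big_nil /F; ring.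
    (* If [z != z'] and [y != y'], the four pairs are distinct and the mean is [0]. Otherwise the
       trivial bound [1] is used, for at most [2 * n ^+ 3] quadruples. *)
    have [yz|] := boolP ((z != z') && (y != y')).
      rewrite [leLHS](_ : _ = 0) ?addr_ge0 //.
      under eq_bigr do rewrite S mulrCA.
      rewrite -mulr_sumr dev_mean0 ?mulr0 //= !inE !xpair_eqE !eqxx /=.
      by move/andP: yz => [/negbTE -> /negbTE ->]; rewrite !andbF.
    rewrite negb_and !negbK => yz.
    apply: le_trans (_ : 1 <= _); last first.
      by move: yz => /orP[]/eqP ->; rewrite eqxx ?lerDl ?lerDr ler0n.
    rewrite -pr_sum1; apply: ler_sum => phi _; rewrite ler_piMr ?pr_ge0 //.
    apply: le_trans (ler_norm _) _.
    have Fle y1 z1 : `|F a phi y1 z1| <= 1.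
      rewrite normrM mulr_ile1 ?dev_le1 //.
      by have /andP[? ?] := sI y1 z1; rewrite ger0_norm.
    have Mle (p q : R) : `|p| <= 1 -> `|q| <= 1 -> `|p * q| <= 1.
      by move=> p1 q1; rewrite normrM mulr_ile1.
    by apply: (Mle); apply: (Mle); exact: Fle.
  rewrite E; apply: le_trans (_ : \sum_z \sum_z' \sum_y \sum_y'
      (((z : V) == z')%:R + ((y : V) == y')%:R) <= _).
    apply: ler_sum => z _; apply: ler_sum => z' _.
    by apply: ler_sum => y _; apply: ler_sum => y' _; exact: B.
  have c (r : R) : \sum_(z : V) r = n * r by rewrite sumr_const mulr_natl.
  have -> : \sum_z \sum_z' \sum_y \sum_y'
      (((z : V) == z')%:R + ((y : V) == y')%:R) = 2 * n ^+ 3 :> R; last by [].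
  under eq_bigr => z _.
    under eq_bigr => z' _.
      under eq_bigr do rewrite big_split /= sum_eqb c.
      rewrite big_split /= !c; over.
    rewrite big_split /= c -!mulr_sumr sum_eqb; over.
  by rewrite c; ring.
(* Bounding the sum over all colours yields a single [phi] that serves every colour, since each
   [D a phi] is nonnegative. *)
have [phi hphi] : exists phi, \sum_a D a phi <= #|C|%:R * (2 * n ^+ 3).
  apply: (exists_le_mean pr_ge0 pr_sum1).
  under eq_bigr do rewrite mulr_sumr.
  rewrite exchange_big /= mulr_natl -sumr_const; exact: ler_sum.
exists (fun y z => phi (y, z)) => a u v uI vI.
have Da : D a phi <= 2 * #|C|%:R * n ^+ 3.
  apply: le_trans (_ : \sum_a D a phi <= _).
    by rewrite (bigD1 a) //= lerDl sumr_ge0.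
  by apply: le_trans hphi _; rewrite mulrCA mulrA.
have := cut_le_C4 (F a phi) uI vI; rewrite -/(D a phi) -/n.
rewrite /F /dev; set S := \sum_y _ => hS.
rewrite -(@ler_pXn2r _ 4) ?nnegrE ?normr_ge0 ?mulr_ge0 ?exprn_ge0 ?(ltW k0) //.
have -> : `|S| ^+ 4 = S ^+ 4 by rewrite -normrX ger0_norm // -[4%N]/(2 * 2)%N exprM sqr_ge0.
apply: le_trans hS _.
rewrite [leRHS](_ : _ = n ^+ 4 * (k ^+ 4 * n * n ^+ 3)); last by ring.
rewrite ler_wpM2l ?exprn_ge0 //; apply: le_trans Da _.
by rewrite ler_wpM2r ?exprn_ge0.
Qed.

End RandomColoring.

(** * Regular clusters *)

Section Regularity.
Variable R : realType.

Section Potential.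
Variables (X J : finType) (f : J -> X -> R).
Hypothesis f01 : forall j, unit_valued (f j).

Definition mean (S : {set X}) j : R := (\sum_(x in S) f j x) / #|S|%:R.

Definition energy (S : {set X}) : R := \sum_j mean S j ^+ 2.

(** The exponential rewards energy, while the factor [#|S|] keeps a maximiser from being too
    small. *)
Definition potential (K : R) (S : {set X}) : R := #|S|%:R * expR (K * energy S).

Lemma mean01 S j : 0 <= mean S j <= 1.
Proof.
have s0 : 0 <= \sum_(x in S) f j x.
  by apply: sumr_ge0 => x _; have /andP[] := f01 j x.
rewrite /mean divr_ge0 //=; have [->|S0] := eqVneq S finset.set0.
  by rewrite cards0 invr0 mulr0 ler01.
rewrite ler_pdivrMr ?ltr0n ?card_gt0 // mul1r -sumr_const; apply: ler_sum => x _.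
by have /andP[] := f01 j x.
Qed.

Lemma energy_le S : 0 <= energy S <= #|J|%:R.
Proof.
apply/andP; split; first by apply: sumr_ge0 => j _; exact: sqr_ge0.
rewrite -sumr_const; apply: ler_sum => j _; have /andP[? ?] := mean01 S j.
by rewrite expr_le1.
Qed.

(* The averages of each [f j] over the parts of [S] have mean [mean S j], so an
   irregular part raises the average of the energy over the parts by [eps ^+ 2];
   [expR y >= 1 + y] then gives some part a larger potential than [S]. *)
Lemma potential_max_regular (B : finType) (p : X -> B) (K eps : R) (S : {set X}) :
  0 < eps -> #|B|%:R <= K * eps ^+ 2 ->
  (forall b, potential K [set x in S | p x == b] <= potential K S) ->
  forall j b, `|\sum_(x in S | p x == b) (f j x - mean S j)| <= eps * #|S|%:R.
Proof.
move=> e0 hK hmax j0 b0; rewrite leNgt; apply/negP => viol.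
have [S0|S0] := eqVneq S finset.set0.
  by move: viol; rewrite S0 cards0 mulr0 big1 ?normr0 ?ltxx // => x; rewrite inE.
pose N : R := #|S|%:R; have N0 : 0 < N by rewrite ltr0n card_gt0.
pose P b := [set x in S | p x == b]%SET; pose n b : R := #|P b|%:R.
pose t j b := \sum_(x in S | p x == b) (f j x - mean S j).
have sumP (g : X -> R) : \sum_b \sum_(x in P b) g x = \sum_(x in S) g x.
  rewrite [RHS](partition_big p predT) //=; apply: eq_bigr => b _.
  by apply: eq_bigl => x; rewrite inE.
have sumn : \sum_b n b = N.
  by rewrite /N -sum1_card natr_sum -sumP; apply: eq_bigr => b _; rewrite /n -sum1_card natr_sum.
have tE j b : t j b = \sum_(x in P b) f j x - n b * mean S j.
  rewrite /t (eq_bigl (mem (P b))); last by move=> x; rewrite !inE.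
  by rewrite sumrB sumr_const mulr_natl.
have sumt j : \sum_b t j b = 0.
  under eq_bigr do rewrite tE; rewrite sumrB -mulr_suml sumn sumP.
  by rewrite /mean mulrC divfK ?subrr // gt_eqF.
(* The square is expanded around [mean S j]; the linear terms cancel over [b] by [sumt]. For an
   empty part the quotient is [0] by convention. *)
have step j b : n b * mean (P b) j ^+ 2 =
    n b * mean S j ^+ 2 + 2 * mean S j * t j b + t j b ^+ 2 / n b.
  rewrite tE; have [nb0|nb0] := eqVneq (n b) 0.
    have /eqP := nb0; rewrite pnatr_eq0 cards_eq0 => /eqP E.
    by rewrite nb0 E big_set0; ring.
  by rewrite {1}/mean -/(n b); field.
(* The term of [j0] and the violating part [b0] alone exceeds [eps ^+ 2 * N], because
   [n b0 <= N]. *)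
have gain : N * energy S + eps ^+ 2 * N < \sum_b n b * energy (P b).
  have -> : \sum_b n b * energy (P b) =
      N * energy S + \sum_j \sum_b t j b ^+ 2 / n b.
    under eq_bigr do rewrite mulr_sumr.
    rewrite exchange_big /= [in RHS]mulr_sumr -big_split; apply: eq_bigr => j _ /=.
    under eq_bigr do rewrite step.
    by rewrite !big_split /= -mulr_suml -mulr_sumr sumt sumn mulr0 addr0.
  rewrite ltrD2l; have n0 b : 0 <= n b by exact: ler0n.
  have t0 j b : 0 <= t j b ^+ 2 / n b by rewrite divr_ge0 ?sqr_ge0.
  rewrite (bigD1 j0) //= (bigD1 b0) //= -addrA ltr_wpDr //.
    by rewrite addr_ge0 ?sumr_ge0 // => j _; rewrite sumr_ge0.
  have nb0 : 0 < n b0.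
    rewrite lt_neqAle n0 andbT eq_sym; apply: contraTneq viol => /eqP.
    rewrite pnatr_eq0 cards_eq0 => /eqP E; rewrite -leNgt -/(t j0 b0) tE.
    by rewrite /n E big_set0 cards0 mul0r subr0 normr0 mulr_ge0 // ltW.
  have nN : n b0 <= N.
    by rewrite ler_nat subset_leq_card //; apply/fintype.subsetP => x; rewrite inE => /andP[].
  rewrite ltr_pdivlMr //; apply: le_lt_trans (_ : (eps * N) ^+ 2 < _).
    by rewrite exprMn [N ^+ 2]expr2 mulrA ler_wpM2l // mulr_ge0 ?sqr_ge0 // ltW.
  rewrite -[ltRHS]real_normK ?num_real //.
  by rewrite ltr_pXn2r ?nnegrE ?mulr_ge0 // ltW.
have K0 : 0 <= K.
  have : 0 <= K * eps ^+ 2 by apply: le_trans hK.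
  by rewrite pmulr_lge0 // exprn_gt0.
(* Maximality bounds each summand by [N], whereas [gain] makes the sum at least [N + N * #|B|]. *)
have : \sum_b n b * expR (K * (energy (P b) - energy S)) <= N * #|B|%:R.
  rewrite mulr_natr -sumr_const; apply: ler_sum => b _.
  rewrite mulrBr expRB mulrA ler_pdivrMr ?expR_gt0 //; exact: hmax.
apply/negP; rewrite -ltNge.
apply: lt_le_trans (_ : _ < \sum_b n b * (1 + K * (energy (P b) - energy S))) _; last first.
  by apply: ler_sum => b _; rewrite ler_wpM2l ?ler0n // expR_ge1Dx.
have -> : \sum_b n b * (1 + K * (energy (P b) - energy S)) =
    N + K * (\sum_b n b * energy (P b) - N * energy S).
  rewrite -sumn mulr_suml -sumrB mulr_sumr -big_split; apply: eq_bigr => b _ /=; ring.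
have : N * #|B|%:R <= K * (eps ^+ 2 * N) by rewrite mulrA mulrC ler_wpM2r // ltW.
have : K * (eps ^+ 2 * N) <= K * (\sum_b n b * energy (P b) - N * energy S).
  by rewrite ler_wpM2l // lerBrDl ltW.
by lra.
Qed.

End Potential.

Section Cylinder.
Variables (m : nat) (V : finType).
Implicit Types W : {ffun 'I_m -> {set V}}.

(** A system of clusters is encoded as one box of [m]-tuples, so that a single maximisation makes
    all pairs of clusters regular. *)
Definition cylinder W : {set {ffun 'I_m -> V}} :=
  [set x : {ffun 'I_m -> V} | [forall k, x k \in W k]]%SET.

Lemma card_cylinder W : #|cylinder W| = (\prod_k #|W k|)%N.
Proof.
rewrite -sum1_card; under [RHS]eq_bigr do rewrite -sum1_card big_mkcond /=.
rewrite bigA_distr_bigA big_mkcond /=; apply: eq_bigr => x _; rewrite inE.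
case: (boolP [forall k, _]) => [/forallP xW|/forallPn[k /negbTE xk]].
  by rewrite big1 // => k _; rewrite xW.
by rewrite (bigD1 k) //= xk mul0n.
Qed.

(** The tuples of a box with two prescribed coordinates form a box again, with two singleton
    sides. *)
Lemma sum_cylinder2 W (i j : 'I_m) (g : V -> V -> R) : i != j ->
  \sum_(x in cylinder W) g (x i) (x j) =
  (\prod_(k | (k != i) && (k != j)) #|W k|)%:R * \sum_(u in W i) \sum_(v in W j) g u v.
Proof.
move=> ij; rewrite (partition_big (fun x : {ffun 'I_m -> V} => (x i, x j))
  (fun q => (q.1 \in W i) && (q.2 \in W j))) /=; last first.
  by move=> x; rewrite inE => /forallP xW; rewrite !xW.
rewrite pair_big mulr_sumr; apply: eq_bigr => -[u v] /= /andP[uW vW].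
rewrite (eq_bigr (fun=> g u v)); last by move=> x /andP[_ /eqP[-> ->]].
rewrite sumr_const -[LHS]mulr_natl; congr (_%:R * _).
pose W' := [ffun k => if k == i then [set u]%SET else if k == j then [set v]%SET else W k].
transitivity #|cylinder W'|.
  apply: eq_card => x; rewrite -topredE /= !inE.
  apply/andP/forallP => [[/forallP xW /eqP[xi xj]] k|xW'].
    rewrite ffunE; case: eqP => [->|_]; first by rewrite xi inE.
    by case: eqP => [->|_]; [rewrite xj inE|].
  have := xW' i; rewrite ffunE eqxx inE => /eqP xi.
  have := xW' j; rewrite ffunE eq_sym (negbTE ij) eqxx inE => /eqP xj.
  split; last by rewrite xi xj.
  apply/forallP => k; have := xW' k; rewrite ffunE.
  by case: eqP => [->|_]; [rewrite xi | case: eqP => [->|_]; [rewrite xj|]].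
rewrite card_cylinder (bigD1 i) //= (bigD1 j) 1?eq_sym //= !ffunE eqxx.
rewrite eq_sym (negbTE ij) eqxx !cards1 !mul1n; apply: eq_bigr => k /andP[ki kj].
by rewrite ffunE (negbTE ki) (negbTE kj).
Qed.

Lemma card_cylinder2 W (i j : 'I_m) : i != j ->
  #|cylinder W| = (\prod_(k | (k != i) && (k != j)) #|W k| * (#|W i| * #|W j|))%N.
Proof.
by move=> ij; rewrite card_cylinder (bigD1 i) //= (bigD1 j) 1?eq_sym //= mulnA mulnC.
Qed.

End Cylinder.

(** The potential of the colour indicators of all coordinate pairs is maximised over the sub-boxes
    of the product of the [I k]. *)
Lemma regular_clusters (m : nat) (C : finType) (eps : R) : 0 < eps ->
  exists2 delta : R, 0 < delta & forall (V : finType) (col : V -> V -> C)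
    (I : 'I_m -> {set V}), (forall k, (0 < #|I k|)%N) ->
  exists (W : 'I_m -> {set V}) (d : 'I_m -> 'I_m -> C -> R),
  [/\ forall k, W k \subset I k, forall k, delta * #|I k|%:R <= #|W k|%:R &
    forall i j, i != j ->
    [/\ forall a, 0 <= d i j a, \sum_a d i j a = 1 &
      forall a (A B : {set V}), A \subset W i -> B \subset W j ->
      `|\sum_(u in A) \sum_(v in B) ((col u v == a)%:R - d i j a)| <=
        eps * #|W i|%:R * #|W j|%:R]].
Proof.
move=> e0; pose J : finType := ('I_m * 'I_m * C)%type.
(* The sets [A] and [B] cut a box into [4] parts; [delta] is the inverse of a bound on the
   exponential factor. *)
pose K : R := 4 / eps ^+ 2; pose delta := expR (- (K * #|J|%:R)).
exists delta; first exact: expR_gt0.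
move=> V col I I0; pose f (j : J) (x : {ffun 'I_m -> V}) : R :=
  (col (x j.1.1) (x j.1.2) == j.2)%:R.
have f01 j : unit_valued (f j) by exact: unit_valued_bool.
pose Phi (W : {ffun 'I_m -> {set V}}) := potential f K (cylinder W).
pose I' := [ffun k => I k].
pose P (W : {ffun 'I_m -> {set V}}) := [forall k, W k \subset I k].
have hI : P I' by apply/forallP => k; rewrite ffunE.
case: (@arg_maxP _ _ _ I' P Phi hI) => W /forallP WI Wmax.
have cI : (0 < #|cylinder I'|)%N.
  by rewrite card_cylinder prodn_gt0 // => k; rewrite ffunE.
have eE S : expR (K * energy f S) <= delta^-1.
  rewrite /delta expRN invrK ler_expR ler_wpM2l //; first by rewrite divr_ge0 ?sqr_ge0.
  by have /andP[] := energy_le f01 S.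
(* The maximiser has at least the potential of the full box, and exponential factors lie between [1]
   and [delta^-1]. *)
have cW : delta * #|cylinder I'|%:R <= #|cylinder W|%:R.
  rewrite mulrC -ler_pdivlMr ?expR_gt0 //.
  apply: le_trans (_ : Phi W <= _); last by rewrite ler_wpM2l.
  apply: le_trans (Wmax _ hI); rewrite ler_peMr // -[leLHS]expR0 ler_expR.
  have /andP[? _] := energy_le f01 (cylinder I').
  by rewrite mulr_ge0 // divr_ge0 ?sqr_ge0.
(* The other sides of the box have only shrunk, so side [k] alone loses at most the factor
   [delta]. *)
have dW k : delta * #|I k|%:R <= #|W k|%:R.
  move: cW; rewrite !card_cylinder (bigD1 k) //= [in X in _ <= X](bigD1 k) //= !natrM mulrA ffunE.
  set p := (X in _ * X <= _); set q := (X in _ <= _ * X) => h.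
  have p0 : 0 < p by rewrite ltr0n prodn_cond_gt0 // => k' _; rewrite ffunE.
  rewrite -(ler_pM2r p0); apply: le_trans h _; rewrite ler_wpM2l //.
  by rewrite ler_nat; apply: leq_prod => k' _; rewrite ffunE subset_leq_card.
have W0 k : (0 < #|W k|)%N.
  by rewrite -(ltr0n R); apply: lt_le_trans (dW k); rewrite mulr_gt0 ?expR_gt0 ?ltr0n.
pose d i j a := mean f (cylinder W) (i, j, a).
exists W, d; split=> // i j ij.
have c0 : (0 < #|cylinder W|)%N by rewrite card_cylinder prodn_gt0.
split=> [a||a A B AW BW].
- by have /andP[] := mean01 f01 (cylinder W) (i, j, a).
- rewrite /d /mean -mulr_suml exchange_big /=.
  rewrite (eq_bigr (fun=> 1)) ?sumr_const ?divff ?pnatr_eq0 -?lt0n // => x _.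
  rewrite /f /= (bigD1 (col (x i) (x j))) //= eqxx big1 ?addr0 // => a.
  by rewrite eq_sym => /negbTE ->.
pose p (x : {ffun 'I_m -> V}) := (x i \in A, x j \in B).
have hK : #|((bool * bool)%type : finType)|%:R <= K * eps ^+ 2.
  by rewrite card_prod card_bool /K divfK // expf_neq0 // gt_eqF.
have in_if (b : bool) (D : {set V}) v : (v \in if b then D else ~: D)%SET = ((v \in D) == b).
  by case: b; rewrite ?inE; case: (v \in D).
(* The four parts are themselves boxes, so they compete in the maximisation. *)
have hm b : potential f K [set x in cylinder W | p x == b] <= potential f K (cylinder W).
  case: b => b1 b2; pose W' := [ffun k =>
    if k == i then W k :&: (if b1 then A else ~: A) else
    if k == j then W k :&: (if b2 then B else ~: B) else W k]%SET.
  have -> : [set x in cylinder W | p x == (b1, b2)]%SET = cylinder W'.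
    apply/setP => x; rewrite !inE; apply/andP/forallP => [[/forallP xW]|xW'].
      rewrite xpair_eqE => /andP[xi xj] k; rewrite ffunE.
      case: eqP => [->|_]; first by rewrite inE xW in_if xi.
      by case: eqP => [->|_] //; rewrite inE xW in_if xj.
    have := xW' i; rewrite ffunE eqxx inE in_if => /andP[xiW xi].
    have := xW' j; rewrite ffunE eq_sym (negbTE ij) eqxx inE in_if => /andP[xjW xj].
    split; last by rewrite xpair_eqE xi xj.
    apply/forallP => k; have := xW' k; rewrite ffunE.
    by case: eqP => [->|_] //; case: eqP => [->|_].
  apply: Wmax; apply/forallP => k; rewrite ffunE; apply: fintype.subset_trans (WI k).
  by case: eqP => _; [|case: eqP => _]; rewrite ?subsetIl.
have := potential_max_regular e0 hK hm (i, j, a) (true, true).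
pose g u v : R := (u \in A)%:R * (v \in B)%:R * ((col u v == a)%:R - d i j a).
rewrite [X in `|X|](_ : _ = \sum_(x in cylinder W) g (x i) (x j)); last first.
  rewrite big_mkcondr; apply: eq_bigr => x _; rewrite /p /g.
  by rewrite xpair_eqE; case: (x i \in A); case: (x j \in B); rewrite /= ?(mulr0, mul0r) ?mul1r.
rewrite sum_cylinder2 // (card_cylinder2 _ ij) natrM normrM normr_nat mulrCA.
rewrite ler_pM2l; last by rewrite ltr0n prodn_cond_gt0.
rewrite natrM mulrA [X in `|X|](_ : _ =
  \sum_(u in A) \sum_(v in B) ((col u v == a)%:R - d i j a)) //.
rewrite big_mkcond [RHS]big_mkcond; apply: eq_bigr => u _.
have [uA|uA] := boolP (u \in A); last first.
  by case: ifP => // _; rewrite big1 // => v _; rewrite /g (negbTE uA) !mul0r.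
rewrite (fintype.subsetP AW) // big_mkcond [RHS]big_mkcond; apply: eq_bigr => v _.
have [vB|vB] := boolP (v \in B); last by rewrite /g (negbTE vB) mulr0 mul0r if_same.
by rewrite (fintype.subsetP BW) // /g uA vB !mul1r.
Qed.

End Regularity.

(** * Ramsey's theorem for pairs *)

Section Ramsey.
Variable K : finType.

Lemma pigeonhole_count (T : Type) (h : T -> K) (m : nat) (l : seq T) :
  (#|K| * m < size l)%N -> exists k, (m < count (fun x => h x == k) l)%N.
Proof.
move=> hl; have E : (\sum_k count (fun x => h x == k) l = size l)%N.
  elim: l {hl} => [|x l IH] /=; first by rewrite big1.
  rewrite big_split IH /= (bigD1 (h x)) //= eqxx big1 // => k.
  by rewrite eq_sym => /negbTE ->.
have [/existsP //|/existsPn hk] := boolP [exists k, (m < count (fun x => h x == k) l)%N].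
move: hl; rewrite -E ltnNge -sum_nat_const leq_sum // => k _.
by rewrite leqNgt hk.
Qed.

Lemma ramsey_end_homogeneous (L : nat) : exists m, forall (T : eqType)
    (chi : T -> T -> K) (l : seq T), (m <= size l)%N ->
  exists s : seq (T * K), [/\ subseq (map fst s) l, size s = L &
    pairwise (fun p q => chi p.1 q.1 == p.2) s].
Proof.
elim: L => [|L [m IH]]; first by exists 0%N => T chi l _; exists [::]; rewrite sub0seq.
exists (#|K| * m).+2 => T chi [|x l] //= hl.
have [k hk] := @pigeonhole_count _ (chi x) m l hl.
have [|s [sl sL sp]] := IH T chi [seq y <- l | chi x y == k].
  by rewrite size_filter ltnW.
exists ((x, k) :: s); split=> /=; last 2 first.
- by rewrite sL.
- rewrite sp andbT; apply/allP => p ps.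
  have := mem_subseq sl (map_f fst ps).
  by rewrite mem_filter => /andP[].
by rewrite eqxx; apply: subseq_trans sl _; exact: filter_subseq.
Qed.

(** Pigeonhole on the labels of an end-homogeneous subsequence of [enum 'I_m]. *)
Lemma ramsey_pairs (M : nat) : exists m, forall chi : 'I_m -> 'I_m -> K,
  exists (s : 'I_M -> 'I_m) (k : K), forall l l' : 'I_M, (l < l')%N ->
    (s l < s l')%N /\ chi (s l) (s l') = k.
Proof.
have [m hm] := ramsey_end_homogeneous (#|K| * M).+1.
exists m => chi; have [|s [sl sL sp]] := hm _ chi (enum 'I_m).
  by rewrite size_enum_ord.
have [|k hk] := @pigeonhole_count _ (snd : 'I_m * K -> K) M s; first by rewrite sL.
set s' := [seq p <- s | p.2 == k].
have s's : subseq s' s by exact: filter_subseq.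
have sM : (M < size s')%N by rewrite size_filter.
case E : s' sM => [//|p0 s''] sM.
exists (fun l : 'I_M => (nth p0 s' l).1), k => l l' ll'.
have lM (i : 'I_M) : (i < size s')%N by rewrite E (ltn_trans (ltn_ord i)).
split.
  have so : sorted ltn (map val (map fst s')).
    have h : subseq (map fst s') (enum 'I_m) by apply: subseq_trans (map_subseq _ s's) sl.
    apply: subseq_sorted (map_subseq val h) _; first exact: ltn_trans.
    by rewrite val_enum_ord iota_ltn_sorted.
  have := sorted_ltn_nth ltn_trans 0%N so l l'; rewrite !inE !size_map !lM => /(_ isT isT ll').
  by rewrite !(nth_map p0.1) ?size_map // !(nth_map p0).
have hs2 : (nth p0 s' l).2 = k.
  by have := mem_nth p0 (lM l); rewrite mem_filter => /andP[/eqP].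
have := subseq_pairwise s's sp; move/(pairwiseP p0) => /(_ l l').
by rewrite !inE !lM hs2 => /(_ isT isT ll') /eqP.
Qed.

End Ramsey.

(** * Palettes *)

Section SortedTriples.
Variables (R : realType) (V : finType) (r : V -> nat).
Hypothesis rI : injective r.

Definition triple_set (p : V * V * V) : {set V} := [set p.1.1; p.1.2; p.2]%SET.

Definition sorted3 (p : V * V * V) : bool :=
  (r p.1.1 < r p.1.2)%N && (r p.1.2 < r p.2)%N.

Lemma sorted3_uniq p : sorted3 p -> uniq [:: p.1.1; p.1.2; p.2].
Proof.
case: p => -[x y] z; rewrite /sorted3 /= !inE negb_or => /andP[xy yz].
rewrite andbT -!(inj_eq rI) !neq_ltn xy yz (ltn_trans xy yz) //.
Qed.

Lemma card_triple_set p : sorted3 p -> #|triple_set p| = 3.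
Proof.
move=> /sorted3_uniq u; rewrite -[RHS](card_uniqP u); apply: eq_card => v.
by rewrite !inE orbA.
Qed.

Lemma triple_set_inj p q : sorted3 p -> sorted3 q -> triple_set p = triple_set q -> p = q.
Proof.
case: p => -[x y] z; case: q => -[x' y'] z'; rewrite /sorted3 /=.
move=> /andP[xy yz] /andP[xy' yz'] E.
have mem v : v \in [:: x; y; z] -> [\/ v = x', v = y' | v = z'].
  move=> vp; have : v \in triple_set (x', y', z').
    by rewrite -E !inE -orbA; move: vp; rewrite !inE.
  by rewrite !inE -orbA => /or3P[]/eqP ->; [constructor 1|constructor 2|constructor 3].
have := (mem x, mem y, mem z); rewrite !inE !eqxx ?orbT => -[[hx hy] hz].
case: (hx isT) => ?; case: (hy isT) => ?; case: (hz isT) => ?; subst => //; lia.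
Qed.

Lemma triple_set_surj (e : {set V}) : #|e| = 3 -> exists2 p, sorted3 p & e = triple_set p.
Proof.
move=> e3; pose le u v := (r u <= r v)%N.
have st : sorted le (sort le (enum e)).
  by apply: sort_sorted => u v; exact: leq_total.
have su : uniq (sort le (enum e)) by rewrite sort_uniq enum_uniq.
have ss : size (sort le (enum e)) = 3 by rewrite size_sort -cardE.
have sm v : (v \in sort le (enum e)) = (v \in e) by rewrite mem_sort mem_enum.
case: (sort le (enum e)) st su ss sm => [//|x [//|y [//|z [|//]]]] /= st su _ sm.
exists (x, y, z).
  move: st su; rewrite /sorted3 /= !inE negb_or !andbT => /andP[xy yz] /andP[/andP[nxy _] nyz].
  by rewrite !ltn_neqAle !(inj_eq rI) nxy nyz; apply/andP.
by apply/setP => v; rewrite -sm !inE orbA.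
Qed.

(** Each 3-set comes from exactly one sorted triple, so sums over 3-sets become sums over ordered
    triples, where the counting lemma applies. *)
Lemma set_poly_sorted (c : {set V} -> R) (w : V -> R) :
  (forall e : {set V}, #|e| != 3 -> c e = 0) ->
  set_poly c w = \sum_x \sum_y \sum_z (sorted3 (x, y, z))%:R *
     (c (triple_set (x, y, z)) * (w x * w y * w z)).
Proof.
move=> c3; rewrite !pair_bigA /= /set_poly.
rewrite (bigID (fun e : {set V} => #|e| == 3)) /= [X in _ + X]big1 ?addr0; last first.
  by move=> e /c3 ->; rewrite mul0r.
have -> : \sum_(e : {set V} | #|e| == 3) c e * \prod_(i in e) w i =
    \sum_(e in [set triple_set p | p in [set p | sorted3 p]]%SET) c e * \prod_(i in e) w i.
  apply: eq_bigl => e; apply/eqP/imsetP => [/triple_set_surj[p ps ->]|[p + ->]].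
    by exists p => //; rewrite inE.
  by rewrite inE => /card_triple_set.
rewrite big_imset /=; last first.
  by move=> p q; rewrite !inE; exact: triple_set_inj.
rewrite big_mkcond /=; apply: eq_bigr => -[[x y] z] _ /=; rewrite inE.
case: ifP => s; last by rewrite mul0r.
rewrite mul1r; congr (_ * _); have u := sorted3_uniq s.
transitivity (\prod_(i <- [:: x; y; z]) w i); last by rewrite !big_cons big_nil mulr1 mulrA.
by rewrite [RHS]big_uniq //; apply: eq_bigl => i; rewrite !inE orbA.
Qed.

(** This expresses the excess of edges over density [d] as a multiaffine polynomial. *)
Lemma set_poly_ksubsets (E : {set {set V}}) (d : R) (U : {set V}) :
  set_poly (fun e => (#|e| == 3)%:R * ((e \in E)%:R - d)) (fun x => (x \in U)%:R) =
  #|(ksubsets 3 U :&: E)%SET|%:R - d * 'C(#|U|, 3)%:R.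
Proof.
have UU (e : {set V}) : \prod_(i in e) (i \in U)%:R = (e \subset U)%:R :> R.
  have [eU|/subsetPn[v ve vU]] := boolP (e \subset U).
    by rewrite big1 // => i ie; rewrite (fintype.subsetP eU).
  by rewrite (bigD1 v) //= (negbTE vU) mul0r.
rewrite /set_poly; under eq_bigr do rewrite UU mulrAC.
rewrite (eq_bigr (fun e : {set V} =>
   ((#|e| == 3) && (e \subset U) && (e \in E))%:R -
     d * ((e \subset U) && (#|e| == 3))%:R)); last first.
  move=> e _; rewrite andbC.
  case: (#|e| == 3); case: (e \subset U); case: (e \in E); rewrite /=; ring.
rewrite sumrB -mulr_sumr; congr (_ - _ * _).
  rewrite -sum1_card natr_sum [RHS]big_mkcond /=; apply: eq_bigr => e _.
  by rewrite !inE; case: (#|e| == 3); case: (e \subset U); case: (e \in E).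
rewrite -cards_draws -sum1_card natr_sum [RHS]big_mkcond /=; apply: eq_bigr => e _.
by rewrite !inE; case: (#|e| == 3); case: (e \subset U).
Qed.

End SortedTriples.

Section Palette.
Variables (R : realType) (C : finType).

Definition palette_poly (T : {set C * C * C}) (x : C -> R) : R :=
  \sum_(p in T) x p.1.1 * x p.1.2 * x p.2.

Definition palette_colorable (T : {set C * C * C}) (H : graph3) : Prop :=
  exists (r : vert H -> nat) (col : vert H -> vert H -> C), injective r /\
    forall x y z, (r x < r y)%N -> (r y < r z)%N ->
      triple_set (x, y, z) \in edges H -> (col x y, col x z, col y z) \in T.

(** Order and colouring are pulled back along the embedding. *)
Lemma palette_colorable_contains T H F :
  palette_colorable T H -> contains H F -> palette_colorable T F.
Proof.
move=> [r [col [rI hT]]] [f fI fE].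
exists (r \o f), (fun x y => col (f x) (f y)); split; first exact: inj_comp.
move=> x y z xy yz /fE; rewrite !imsetU !imset_set1; exact: hT.
Qed.

End Palette.

(** * Ordered clusters with common colour densities *)

Section Clusters.
Variable R : realType.

(** The intervals are consecutive blocks in the list of vertices sorted by rank. *)
Lemma rank_intervals (V : finType) (r : V -> nat) (m : nat) : injective r ->
  (0 < #|V|)%N -> exists I : 'I_m -> {set V},
  (forall k, #|I k| = #|V| %/ m)%N /\
  forall k k' : 'I_m, (k < k')%N -> forall x y, x \in I k -> y \in I k' -> (r x < r y)%N.
Proof.
move=> rI /card_gt0P[x0 _]; set q := (#|V| %/ m)%N.
pose s := sort (relpre r leq) (enum V).
have sz : size s = #|V| by rewrite size_sort -cardE.
have su : uniq s by rewrite sort_uniq enum_uniq.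
have ss : sorted (relpre r leq) s by apply: sort_sorted => u v; exact: leq_total.
have lt_s i (k : 'I_m) : (i < q)%N -> (k * q + i < size s)%N.
  move=> iq; rewrite sz; apply: leq_trans (leq_trunc_div #|V| m); rewrite -/q.
  have := ltn_ord k; nia.
exists (fun k : 'I_m => [set nth x0 s (k * q + i)%N | i : 'I_q]%SET); split=> [k|k k' kk' x y].
  rewrite card_imset ?card_ord // => i i' /eqP.
  by rewrite nth_uniq ?lt_s // eqn_add2l => /eqP /val_inj.
move=> /imsetP[i _ ->] /imsetP[i' _ ->].
have ltk : (k * q + i < k' * q + i')%N by have := ltn_ord i; nia.
rewrite ltn_neqAle (inj_eq rI) nth_uniq ?lt_s // neq_ltn ltk /=.
have /(_ x0 s ss) := @sorted_ltn_nth _ (relpre r leq) (fun a b c => @leq_trans _ _ _).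
by apply; rewrite ?inE ?lt_s.
Qed.

(* Regular clusters with densities rounded to multiples of [1 / q], on which
   Ramsey's theorem equalises the rounded densities; [d] is the density vector
   of one pair, so that it lies in the simplex exactly. *)
Lemma homogeneous_clusters (C : finType) (M : nat) (k : R) : (1 < M)%N -> 0 < k ->
  exists (delta : R) (n0 : nat), 0 < delta /\
  forall (V : finType) (r : V -> nat) (col : V -> V -> C), injective r ->
    (0 < #|V|)%N -> (n0 <= #|V|)%N ->
  exists (W : 'I_M -> {set V}) (d : C -> R),
  [/\ forall l, delta * #|V|%:R <= #|W l|%:R,
    forall l l' : 'I_M, (l < l')%N ->
      forall x y, x \in W l -> y \in W l' -> (r x < r y)%N,
    simplex R C d &
    forall l l' : 'I_M, (l < l')%N -> forall a (A B : {set V}),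
      A \subset W l -> B \subset W l' ->
      `|\sum_(u in A) \sum_(v in B) ((col u v == a)%:R - d a)| <=
        k * #|W l|%:R * #|W l'|%:R].
Proof.
(* Since [q] exceeds [2 / k], densities with the same rounding differ by at most [k / 2]. *)
move=> M1 k0; pose q : R := (Num.truncn (2 / k)).+1%:R.
have q0 : 0 < q by rewrite ltr0n.
have qk : q^-1 <= k / 2.
  rewrite -[leRHS]invrK lef_pV2 ?posrE ?invr_gt0 ?divr_gt0 // invf_div.
  exact/ltW/truncnS_gt.
pose q' := Num.truncn q.
have [m hm] := ramsey_pairs {ffun C -> 'I_q'.+1} M.
have [delta delta0 hd] := @regular_clusters R m C (k / 2) ltac:(by rewrite divr_gt0).
have m0 : (0 < m)%N.
  have [s _] := hm (fun _ _ => [ffun=> ord0]).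
  by case: (m) (s (Ordinal (ltnW M1))) => // -[].
(* The factor [2] absorbs the rounding in [#|V| %/ m], as [m <= #|V|]. *)
exists (delta / (2 * m%:R)), m; split; first by rewrite divr_gt0 // mulr_gt0 ?ltr0n.
move=> V r col rI V0 mV.
have [I [cI oI]] := rank_intervals m rI V0.
have qV : (0 < #|V| %/ m)%N by rewrite divn_gt0.
have [|W [d [WI dW hW]]] := hd V col I; first by move=> i; rewrite cI.
have [s [c hs]] := hm (fun i j => [ffun a => inord (Num.truncn (d i j a * q))]).
have sneq (l l' : 'I_M) : (l < l')%N -> s l != s l'.
  by move=> ll'; have [h _] := hs _ _ ll'; rewrite -(inj_eq val_inj) neq_ltn h.
have aux (x y z : R) : z <= x -> x < z + 1 -> z <= y -> y < z + 1 -> -1 <= x - y <= 1 by lra.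
pose l0 : 'I_M := Ordinal (ltnW M1); pose l1 : 'I_M := Ordinal M1.
pose d0 := d (s l0) (s l1).
have [d0_ge0 d0_sum _] := hW _ _ (sneq l0 l1 isT).
have dle i j a : i != j -> 0 <= d i j a * q <= q.
  move=> ij; have [h1 h2 _] := hW _ _ ij; rewrite mulr_ge0 ?h1 ?(ltW q0) //=.
  by rewrite ler_piMl ?(ltW q0) // -h2 (bigD1 a) //= lerDl sumr_ge0.
have close (l l' : 'I_M) a : (l < l')%N -> `|d (s l) (s l') a - d0 a| <= k / 2.
  move=> ll'; apply: le_trans qk.
  have [_ e1] := hs _ _ ll'; have [_ e0] := hs l0 l1 isT.
  have := congr1 (fun g : {ffun C -> 'I_q'.+1} => val (g a)) (etrans e1 (esym e0)).
  have /andP[a0 aq] := dle _ _ a (sneq _ _ ll').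
  have /andP[b0 bq] := dle _ _ a (sneq l0 l1 isT).
  rewrite !ffunE /= !inordK ?ltnS ?le_truncn // => E.
  have /andP[h1 h2] := truncn_itv a0; have /andP[h3 h4] := truncn_itv b0.
  rewrite -(ler_pM2r q0) mulVf ?gt_eqF // -[X in _ * X](gtr0_norm q0) -normrM mulrBl.
  move: h1 h2 h3 h4; rewrite E -!natr1 ler_norml /d0.
  exact: aux.
exists (fun l => W (s l)), d0; split.
- move=> l; apply: le_trans (dW (s l)); rewrite cI -mulrA ler_wpM2l ?(ltW delta0) //.
  rewrite ler_pdivrMl ?mulr_gt0 ?ltr0n // -!natrM ler_nat.
  have := divn_eq #|V| m; have := ltn_pmod #|V| m0; nia.
- move=> l l' ll' x y xW yW; have [h _] := hs _ _ ll'.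
  by apply: (oI _ _ h); apply: (fintype.subsetP (WI _)).
- split=> // a; rewrite d0_ge0 /=.
  by rewrite -d0_sum (bigD1 a) //= lerDl sumr_ge0.
move=> l l' ll' a A B AW BW; have [_ _ h] := hW _ _ (sneq _ _ ll').
have {h} := h a A B AW BW; set S := (X in `|X| <= _) => h.
(* One half of [k] pays for regularity, the other for replacing the density of the pair by [d0]. *)
rewrite [X in `|X|](_ : _ = S + \sum_(u in A) \sum_(v in B) (d (s l) (s l') a - d0 a)); last first.
  rewrite /S -big_split; apply: eq_bigr => u _; rewrite -big_split; apply: eq_bigr => v _ /=.
  ring.
apply: le_trans (ler_normD _ _) _.
have -> : k * #|W (s l)|%:R * #|W (s l')|%:R =
   k / 2 * #|W (s l)|%:R * #|W (s l')|%:R + k / 2 * #|W (s l)|%:R * #|W (s l')|%:R by field.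
apply: lerD => //.
rewrite [X in `|X|](_ : _ = #|A|%:R * #|B|%:R * (d (s l) (s l') a - d0 a)); last first.
  by rewrite !sumr_const -mulrnA -[LHS]mulr_natl natrM; ring.
rewrite normrM ger0_norm // [leRHS](_ : _ = #|W (s l)|%:R * #|W (s l')|%:R * (k / 2)); last by ring.
by apply: ler_pM; rewrite ?mulr_ge0 ?close // ler_pM // ler_nat subset_leq_card.
Qed.

End Clusters.

(** After cancelling [3 + t], this is [(3 + t) * t <= (2 + t) * (1 + t)]. *)
Lemma bin3_ge (t : nat) : ((3 + t) ^ 2 * t <= 6 * 'C(3 + t, 3))%N.
Proof.
rewrite [leqRHS]mulnC -[6%N]/(3`!)%N bin_ffact !ffactnS ffactn0 /= expnS expn1 -mulnA.
by rewrite leq_mul2l; apply/orP; right; nia.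
Qed.

(** With no edges and density [-1], the polynomial of [set_poly_ksubsets] gives every 3-set the
    coefficient [1]. *)
Lemma sum_increasing_triples (R : realType) (M : nat) :
  \sum_(l1 < M) \sum_(l2 < M) \sum_(l3 < M) ((l1 < l2)%N && (l2 < l3)%N)%:R = 'C(M, 3)%:R :> R.
Proof.
have := @set_poly_sorted R 'I_M val val_inj
  (fun e => (#|e| == 3)%:R * ((e \in (finset.set0 : {set {set 'I_M}}))%:R - (-1)))
  (fun x => (x \in [set: 'I_M]%SET)%:R).
rewrite set_poly_ksubsets finset.setI0 cards0 cardsT card_ord mulN1r !opprK add0r => ->; last first.
  by move=> e /negbTE ->; rewrite mul0r.
apply: eq_bigr => l1 _; apply: eq_bigr => l2 _; apply: eq_bigr => l3 _.
rewrite !inE; have [s|] := boolP (sorted3 _ _); last by rewrite /sorted3 /= mul0r => /negbTE ->.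
rewrite (card_triple_set val_inj s) eqxx; move: s; rewrite /sorted3 /= => ->.
by rewrite add0r !mul1r.
Qed.

Lemma sum_coincidences (R : realType) (M : nat) :
  \sum_(l1 < M) \sum_(l2 < M) \sum_(l3 < M)
    ((l1 == l2)%:R + (l1 == l3)%:R + (l2 == l3)%:R) = 3 * M%:R ^+ 2 :> R.
Proof.
have cst (x : R) : \sum_(l : 'I_M) x = M%:R * x by rewrite sumr_const card_ord mulr_natl.
under eq_bigr => l1 _.
  under eq_bigr => l2 _ do rewrite big_split big_split /= cst !sum_eqb.
  rewrite !big_split /= -mulr_sumr sum_eqb !cst; over.
by rewrite cst; ring.
Qed.

(** * Upper bound for the density of palette-colourable 3-graphs *)

Section UpperBound.
Variables (R : realType) (C : finType) (T : {set C * C * C}).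

(** Uniform density passes from sets to weightings, since a multiaffine polynomial is minimised at a
    set. *)
Lemma dense_set_poly (d eta : R) (H : graph3) (w : vert H -> R) :
  uniformly_dense d eta H -> unit_valued w ->
  - (eta * #|vert H|%:R ^+ 3) <=
  set_poly (fun e => (#|e| == 3)%:R * ((e \in edges H)%:R - d)) w.
Proof.
move=> hd wI; have [U] := set_poly_min_at_sets
  (fun e => (#|e| == 3)%:R * ((e \in edges H)%:R - d)) wI.
apply: le_trans; rewrite set_poly_ksubsets.
by have := hd U; lra.
Qed.

(** If [d > L], equal masses on many homogeneous clusters violate [dense_set_poly]: increasing
    cluster triples have a deficit, and triples with a repeated cluster are too few to make up for
    it. *)
Lemma palette_density_le (L : R) :
  (forall x, simplex R C x -> palette_poly T x <= L) ->
  forall d : R, 0 <= d ->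
  (forall (eta : R) (n : nat), 0 < eta -> exists H : graph3,
    [/\ palette_colorable T H, uniformly_dense d eta H & (n <= #|vert H|)%N]) ->
  d <= L.
Proof.
move=> hL d d_ge0 hd; rewrite leNgt; apply/negP => Ld.
pose eps := d - L; have eps0 : 0 < eps by rewrite subr_gt0.
(* With [48], the increasing triples contribute a deficit of at least [4 * M ^ 2], against
   [3 * M ^ 2] from coincidences. *)
pose M := (3 + (Num.truncn (48 / eps)).+1)%N.
have M3 : 48 <= (M%:R - 3) * eps.
  rewrite -ler_pdivrMr // /M natrD addrAC subrr add0r; exact/ltW/truncnS_gt.
have T0 : 0 <= #|T|%:R :> R by [].
(* Each element of [T] costs a counting error of [3 * k]; together they cost at most [eps / 2]. *)
pose k : R := eps / (6 * (#|T|%:R + 1)).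
have k0 : 0 < k by rewrite divr_gt0 // mulr_gt0 //; lra.
have kT : 3 * k * #|T|%:R <= eps / 2.
  rewrite /k [leLHS](_ : _ = eps / 2 * (#|T|%:R / (#|T|%:R + 1))); last by field; lra.
  by rewrite ler_piMr ?divr_ge0 ?(ltW eps0) // ler_pdivrMr; lra.
have [delta [n0 [delta0 hW]]] := @homogeneous_clusters R C M k isT k0.
(* The deficit will be at least [(delta * N) ^+ 3], twice what this [eta] permits. *)
have [|H [[r [col [rI hT]]] Hd Hn]] := hd (delta ^+ 3 / 2) (maxn n0 1).
  by rewrite divr_gt0 ?exprn_gt0.
move: Hn; rewrite geq_max => /andP[Hn0 H0].
set V := vert H in r col rI hT H0 Hn0 *.
have [W [dd [Wsz Word ddS Wreg]]] := hW V r col rI H0 Hn0.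
pose N : R := #|V|%:R; have N0 : 0 < N by rewrite ltr0n.
have W0 l : (0 : R) < #|W l|%:R by apply: lt_le_trans (Wsz l); rewrite mulr_gt0.
pose om l v : R := (v \in W l)%:R / #|W l|%:R.
have om0 l v : 0 <= om l v by rewrite divr_ge0.
have om1 l : \sum_v om l v = 1.
  rewrite -mulr_suml (eq_bigr (fun v => if v \in W l then 1 else 0 : R)); last first.
    by move=> v _; case: (v \in W l).
  by rewrite -big_mkcond sumr_const divff // gt_eqF.
have Wdisj l l' v : v \in W l -> v \in W l' -> l = l'.
  move=> vl vl'; case: (ltngtP l l') => [ll|ll|/val_inj //].
    by have := Word _ _ ll _ _ vl vl'; rewrite ltnn.
  by have := Word _ _ ll _ _ vl' vl; rewrite ltnn.
(* Mass [c] per cluster keeps the weights at most [1]: the clusters are disjoint and have at least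
   [c] vertices each. *)
pose c := delta * N; have c0 : 0 < c by rewrite mulr_gt0.
pose w v := \sum_l c * om l v.
have wI : unit_valued w.
  move=> v; rewrite sumr_ge0 /=; last by move=> l _; rewrite mulr_ge0 // ltW.
  have [/existsP[l vl]|/existsPn nv] := boolP [exists l, v \in W l].
    rewrite /w (bigD1 l) //= big1 ?addr0; last first.
      move=> l' l'l; rewrite /om; case: (boolP (v \in W l')) => [vl'|]; last by rewrite mul0r mulr0.
      by move: l'l; rewrite (Wdisj _ _ _ vl vl') eqxx.
    by rewrite /om vl mul1r ler_pdivrMr // mul1r.
  by rewrite /w big1 ?ler01 // => l _; rewrite /om (negbTE (nv l)) mul0r mulr0.
have /= := dense_set_poly Hd wI.
rewrite (set_poly_sorted rI); last by move=> e /negbTE ->; rewrite mul0r.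
apply/negP; rewrite -ltNge.
pose e3 x y z : R := (triple_set (x, y, z) \in edges H)%:R - d.
pose S l1 l2 l3 := \sum_x \sum_y \sum_z
  (sorted3 r (x, y, z))%:R * (e3 x y z * (om l1 x * om l2 y * om l3 z)).
have -> : \sum_x \sum_y \sum_z (sorted3 r (x, y, z))%:R *
    ((#|triple_set (x, y, z)| == 3)%:R * ((triple_set (x, y, z) \in edges H)%:R - d) *
      (w x * w y * w z)) = c ^+ 3 * \sum_l1 \sum_l2 \sum_l3 S l1 l2 l3.
  transitivity (\sum_x \sum_y \sum_z \sum_l1 \sum_l2 \sum_l3 c ^+ 3 *
     ((sorted3 r (x, y, z))%:R * (e3 x y z * (om l1 x * om l2 y * om l3 z)))).
    apply: eq_bigr => x _; apply: eq_bigr => y _; apply: eq_bigr => z _.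
    have -> : w x * w y * w z =
        \sum_l1 \sum_l2 \sum_l3 c ^+ 3 * (om l1 x * om l2 y * om l3 z).
      rewrite /w mulr_suml mulr_suml; apply: eq_bigr => l1 _.
      rewrite -mulrA mulr_suml mulr_sumr; apply: eq_bigr => l2 _.
      by rewrite !mulr_sumr; apply: eq_bigr => l3 _; ring.
    rewrite !mulr_sumr; apply: eq_bigr => l1 _; rewrite !mulr_sumr.
    apply: eq_bigr => l2 _; rewrite !mulr_sumr; apply: eq_bigr => l3 _.
    have [s|] := boolP (sorted3 r (x, y, z)); last by rewrite !mul0r mulr0.
    by rewrite (card_triple_set rI s) eqxx /e3 !mul1r; ring.
  rewrite mulr_sumr.
  under eq_bigr => x _ do under eq_bigr => y _ do rewrite exchange_big.
  under eq_bigr => x _ do rewrite exchange_big.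
  rewrite exchange_big; apply: eq_bigr => l1 _ /=.
  rewrite mulr_sumr.
  under eq_bigr => x _ do under eq_bigr => y _ do rewrite exchange_big.
  under eq_bigr => x _ do rewrite exchange_big.
  rewrite exchange_big; apply: eq_bigr => l2 _ /=.
  rewrite mulr_sumr.
  under eq_bigr => x _ do under eq_bigr => y _ do rewrite exchange_big.
  under eq_bigr => x _ do rewrite exchange_big.
  rewrite exchange_big; apply: eq_bigr => l3 _ /=.
  rewrite /S mulr_sumr; apply: eq_bigr => x _; rewrite mulr_sumr.
  by apply: eq_bigr => y _; rewrite mulr_sumr.
pose inc (l1 l2 l3 : 'I_M) := (l1 < l2)%N && (l2 < l3)%N.
pose nd (l1 l2 l3 : 'I_M) : R := (l1 == l2)%:R + (l1 == l3)%:R + (l2 == l3)%:R.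
have prod1 l1 l2 l3 (F : R) : \sum_x \sum_y \sum_z F * (om l1 x * om l2 y * om l3 z) = F.
  under eq_bigr => x _.
    under eq_bigr => y _.
      rewrite (eq_bigr (fun z => F * om l1 x * om l2 y * om l3 z)); last by move=> z _; ring.
      rewrite -mulr_sumr om1 mulr1; over.
    rewrite -mulr_sumr om1 mulr1; over.
  by rewrite -mulr_sumr om1 mulr1.
pose g a u v : R := (col u v == a)%:R.
have ddI a : 0 <= dd a <= 1 by have [] := ddS.
have cut (l l' : 'I_M) a : (l < l')%N -> cut_le k (om l) (om l') (fun u v => g a u v - dd a).
  move=> ll'; apply: cut_le_of_sets => A B.
  have hW' := Wreg l l' ll' a (A :&: W l)%SET (B :&: W l')%SET (subsetIr _ _) (subsetIr _ _).
  rewrite [X in `|X|](_ : _ = (\sum_(u in A :&: W l) \sum_(v in B :&: W l') (g a u v - dd a))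
      / (#|W l|%:R * #|W l'|%:R)); last first.
    rewrite mulr_suml [RHS]big_mkcond [LHS]big_mkcond; apply: eq_bigr => u _; rewrite inE.
    case: (u \in A) => //=; rewrite mulr_suml /om; case: (u \in W l); last first.
      by rewrite big1 // => v _; rewrite !mul0r.
    rewrite [RHS]big_mkcond [LHS]big_mkcond; apply: eq_bigr => v _; rewrite inE.
    case: (v \in B) => //=; case: (v \in W l'); last by rewrite mul0r mulr0 mul0r.
    by rewrite !mul1r invfM mulrC.
  rewrite normrM [X in _ * X]ger0_norm ?invr_ge0 ?mulr_ge0 //.
  by rewrite ler_pdivrMr ?mulr_gt0 // mulrA.
(* An edge across increasing clusters has its colour triple in [T], so it is dominated by the sum of
   the [G p]. The counting lemma turns this sum into [palette_poly T dd], which is at most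
   [d - eps]. *)
have S_inc l1 l2 l3 : inc l1 l2 l3 -> S l1 l2 l3 <= - (eps / 2).
  move=> /andP[l12 l23]; have l13 := ltn_trans l12 l23.
  pose G (p : C * C * C) x y z := g p.1.1 x y * g p.1.2 x z * g p.2 y z.
  pose D (p : C * C * C) := dd p.1.1 * dd p.1.2 * dd p.2.
  apply: le_trans (_ : \sum_x \sum_y \sum_z
      (\sum_(p in T) G p x y z - d) * (om l1 x * om l2 y * om l3 z) <= _).
    apply: ler_sum => x _; apply: ler_sum => y _; apply: ler_sum => z _.
    have [xW|xW] := boolP (x \in W l1); last first.
      by rewrite [om l1 x]/om (negbTE xW) !mul0r !mulr0.
    have [yW|yW] := boolP (y \in W l2); last first.
      by rewrite [om l2 y]/om (negbTE yW) !(mul0r, mulr0).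
    have [zW|zW] := boolP (z \in W l3); last first.
      by rewrite [om l3 z]/om (negbTE zW) !(mul0r, mulr0).
    have xy := Word _ _ l12 _ _ xW yW; have yz := Word _ _ l23 _ _ yW zW.
    rewrite /sorted3 /= xy yz mul1r ler_wpM2r ?mulr_ge0 // lerD2r.
    have G0 p : 0 <= G p x y z by rewrite !mulr_ge0.
    have [/(hT _ _ _ xy yz) pT|_] := boolP (_ \in edges H); last by rewrite sumr_ge0.
    by rewrite (bigD1 (col x y, col x z, col y z)) //= /G /g /= !eqxx !mul1r lerDl sumr_ge0.
  have -> : \sum_x \sum_y \sum_z
      (\sum_(p in T) G p x y z - d) * (om l1 x * om l2 y * om l3 z) =
    \sum_(p in T) (\sum_x \sum_y \sum_z om l1 x * om l2 y * om l3 z * (G p x y z - D p))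
      + palette_poly T dd - d.
    rewrite -[d in RHS](prod1 l1 l2 l3) -(prod1 l1 l2 l3 (palette_poly T dd)).
    under [X in X + _ - _]eq_bigr do rewrite pair_bigA pair_bigA.
    rewrite !pair_bigA [X in _ = X + _ - _]exchange_big /= -big_split -sumrB /=.
    apply: eq_bigr => -[[x y] z] _ /=.
    under [X in _ = X + _ - _]eq_bigr do rewrite mulrC.
    by rewrite -mulr_suml sumrB /palette_poly -/(D _); ring.
  have hD : palette_poly T dd <= L by exact: hL.
  have : \sum_(p in T) (\sum_x \sum_y \sum_z om l1 x * om l2 y * om l3 z *
      (G p x y z - D p)) <= 3 * k * #|T|%:R.
    rewrite [leRHS]mulr_natr -sumr_const; apply: ler_sum => p _.
    apply: le_trans (ler_norm _) _; rewrite [3 * k](_ : _ =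
      k * (\sum_x om l1 x + \sum_x om l2 x + \sum_x om l3 x)); last by rewrite !om1; ring.
    have gI a x : unit_valued (g a x) by exact: unit_valued_bool.
    apply: (@triangle_counting _ _ k (om l1) (om l2) (om l3) (g p.1.1) (g p.1.2) (g p.2)
      (fun _ _ => dd p.1.1) (fun _ _ => dd p.1.2) (fun _ _ => dd p.2)).
    1-3: exact: om0.
    1-2: exact: gI.
    1-2: by move=> x y; exact: ddI.
    - exact: (cut _ _ p.1.1 l12).
    - exact: (cut _ _ p.1.2 l13).
    - exact: (cut _ _ p.2 l23).
  move: kT hD; rewrite /eps; lra.
(* Distinct clusters that do not increase carry no sorted triple; in the other cases the excess is
   at most [1], as [d] is nonnegative. *)
have S_noninc l1 l2 l3 : ~~ inc l1 l2 l3 -> S l1 l2 l3 <= nd l1 l2 l3.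
  move=> ninc; rewrite -[leRHS](prod1 l1 l2 l3).
  apply: ler_sum => x _; apply: ler_sum => y _; apply: ler_sum => z _.
  have [xW|xW] := boolP (x \in W l1); last first.
    by rewrite [om l1 x]/om (negbTE xW) !(mul0r, mulr0).
  have [yW|yW] := boolP (y \in W l2); last first.
    by rewrite [om l2 y]/om (negbTE yW) !(mul0r, mulr0).
  have [zW|zW] := boolP (z \in W l3); last first.
    by rewrite [om l3 z]/om (negbTE zW) !(mul0r, mulr0).
  rewrite mulrA ler_wpM2r ?mulr_ge0 // /nd.
  have [/andP[/= xy yz]|_] := boolP (sorted3 r (x, y, z)); last first.
    by rewrite mul0r !addr_ge0.
  have e31 : 1 * e3 x y z <= 1.
    by rewrite mul1r /e3 lerBlDr; apply: le_trans (_ : 1 <= _); rewrite ?lern1 ?leq_b1 // lerDl.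
  apply: le_trans e31 _.
  case: (eqVneq l1 l2) => [_|n12]; first by rewrite -addrA lerDl addr_ge0.
  case: (eqVneq l1 l3) => [_|n13]; first by rewrite add0r lerDl.
  case: (eqVneq l2 l3) => [_|n23]; first by rewrite !add0r.
  have lt_of (l l' : 'I_M) u v : l != l' -> u \in W l -> v \in W l' -> (r u < r v)%N -> (l < l')%N.
    move=> ll' uW vW uv; case: (ltngtP l l') => // [l'l|/val_inj E].
      by have := Word _ _ l'l _ _ vW uW; rewrite ltnNge (ltnW uv).
    by rewrite E eqxx in ll'.
  by move: ninc; rewrite /inc (lt_of _ _ _ _ n12 xW yW xy) (lt_of _ _ _ _ n23 yW zW yz).
have binM : M%:R ^+ 2 * (M%:R - 3) <= 6 * 'C(M, 3)%:R :> R.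
  have -> : M%:R - 3 = (Num.truncn (48 / eps)).+1%:R :> R by rewrite /M natrD addrAC subrr add0r.
  rewrite -natrX -!natrM ler_nat.
  exact: bin3_ge.
have sumS : \sum_l1 \sum_l2 \sum_l3 S l1 l2 l3 <= - (M%:R ^+ 2).
  apply: le_trans (_ : \sum_l1 \sum_l2 \sum_l3
      (- (eps / 2) * (inc l1 l2 l3)%:R + nd l1 l2 l3) <= _).
    apply: ler_sum => l1 _; apply: ler_sum => l2 _; apply: ler_sum => l3 _.
    have nd0 : 0 <= nd l1 l2 l3 by rewrite !addr_ge0.
    have [i|i] := boolP (inc l1 l2 l3).
      by rewrite mulr1; have := S_inc _ _ _ i; lra.
    by rewrite mulr0 add0r S_noninc.
  under eq_bigr => l1 _.
    under eq_bigr => l2 _ do rewrite big_split /= -mulr_sumr.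
    rewrite big_split /= -mulr_sumr; over.
  rewrite big_split /= -mulr_sumr sum_increasing_triples sum_coincidences.
  have : M%:R ^+ 2 * 48 <= M%:R ^+ 2 * ((M%:R - 3) * eps) by rewrite ler_wpM2l ?sqr_ge0.
  have : M%:R ^+ 2 * (M%:R - 3) * eps <= 6 * 'C(M, 3)%:R * eps by rewrite ler_wpM2r // ltW.
  set a := M%:R ^+ 2; set b : R := 'C(M, 3)%:R; rewrite mulrA; set e := a * _ * _; lra.
have M1 : 1 <= M%:R ^+ 2 :> R by rewrite -natrX ler1n.
apply: le_lt_trans (_ : - c ^+ 3 < _).
  rewrite -mulrN1 ler_pM2l ?exprn_gt0 //; apply: le_trans sumS _; rewrite lerN2 //.
rewrite ltrN2 -/V -/N /c exprMn; have := exprn_gt0 3 delta0; have := exprn_gt0 3 N0.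
move: (delta ^+ 3) (N ^+ 3) => a b *; nra.
Qed.

End UpperBound.

(** * Lower bound from quasirandom colourings *)

Section LowerBound.
Variables (R : realType) (C : finType) (T : {set C * C * C}) (x : C -> R).
Hypothesis xS : simplex R C x.

(** Over all colour triples the monomials sum to the cube of [\sum_a x a], which is [1]. *)
Lemma palette_poly01 : 0 <= palette_poly T x <= 1.
Proof.
have [xI x1] := xS; have x0 a : 0 <= x a by have /andP[] := xI a.
rewrite sumr_ge0 /=; last by move=> p _; rewrite !mulr_ge0.
apply: le_trans (_ : \sum_p x p.1.1 * x p.1.2 * x p.2 <= _).
  by rewrite /palette_poly big_mkcond; apply: ler_sum => p _; case: ifP => // _; rewrite !mulr_ge0.
rewrite -(pair_bigA _ (fun q c => x q.1 * x q.2 * x c)) /=.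
rewrite -(pair_bigA _ (fun a b => \sum_c x a * x b * x c)) /=.
under eq_bigr => a _.
  under eq_bigr => b _ do rewrite -mulr_sumr x1 mulr1.
  rewrite -mulr_sumr x1 mulr1; over.
by rewrite x1.
Qed.

Definition palette_edges (V : finType) (r : V -> nat) (col : V -> V -> C) : {set {set V}} :=
  [set triple_set p | p in [set p : V * V * V | sorted3 r p &&
    ((col p.1.1 p.1.2, col p.1.1 p.2, col p.1.2 p.2) \in T)]]%SET.

Lemma palette_edges_sub (V : finType) (r : V -> nat) (col : V -> V -> C) :
  injective r -> palette_edges r col \subset ksubsets 3 [set: V]%SET.
Proof.
move=> rI; apply/fintype.subsetP => e /imsetP[p]; rewrite inE => /andP[ps _] ->.
by rewrite inE (card_triple_set rI ps) eqxx andbT; apply/fintype.subsetP => v; rewrite inE.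
Qed.

Lemma mem_palette_edges (V : finType) (r : V -> nat) (col : V -> V -> C) a b c :
  injective r -> sorted3 r (a, b, c) ->
  (triple_set (a, b, c) \in palette_edges r col) = ((col a b, col a c, col b c) \in T).
Proof.
move=> rI s; apply/imsetP/idP => [[p + /esym E]|abc].
  by rewrite inE => /andP[ps]; rewrite (triple_set_inj ps s E).
by exists (a, b, c); rewrite // inE s.
Qed.

(** On ['I_N] with its natural order, all triples allowed by a quasirandom colouring become edges.
    The excess inside [U] is then a sum over [T] of counting-lemma differences. *)
Lemma palette_density_ge (eta : R) (n : nat) : 0 < eta -> exists H : graph3,
  [/\ palette_colorable T H, uniformly_dense (palette_poly T x) eta H &
    (n <= #|vert H|)%N].
Proof.
move=> eta0; have [xI x1] := xS; have x0 a : 0 <= x a by have /andP[] := xI a.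
have T0 : 0 <= #|T|%:R :> R by [].
pose k : R := eta / (3 * (#|T|%:R + 1)).
have k0 : 0 < k by rewrite divr_gt0 // mulr_gt0 //; lra.
have kT : 3 * k * #|T|%:R <= eta.
  rewrite /k [leLHS](_ : _ = eta * (#|T|%:R / (#|T|%:R + 1))); last by field; lra.
  by rewrite ler_piMr ?(ltW eta0) // ler_pdivrMr; lra.
pose N := maxn n (Num.truncn (2 * #|C|%:R / k ^+ 4)).+1.
have hN : 2 * #|C|%:R <= k ^+ 4 * #|'I_N|%:R.
  rewrite card_ord [leRHS]mulrC -ler_pdivrMr ?exprn_gt0 //.
  apply: le_trans (ltW (truncnS_gt _)) _; rewrite ler_nat /N.
  exact: leq_maxr.
(* The mask makes the product over the three pairs vanish off sorted triples. *)
pose s (y z : 'I_N) : R := (y < z)%N%:R.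
have sI y : unit_valued (s y) by exact: unit_valued_bool.
have [col hcol] := quasirandom_coloring x0 x1 sI k0 hN.
pose H := Graph3 (palette_edges_sub col (@val_inj _ _ 'I_N)).
exists H; split; last by rewrite card_ord leq_maxl.
  exists val, col; split=> [|a b c ab bc]; first exact: val_inj.
  by rewrite /= mem_palette_edges //; [exact: val_inj | rewrite /sorted3 /= ab].
move=> U; rewrite -subr_ge0 opprB addrCA addrC -set_poly_ksubsets.
rewrite (set_poly_sorted val_inj); last by move=> e /negbTE ->; rewrite mul0r.
pose u (v : 'I_N) : R := (v \in U)%:R.
have uI : unit_valued u by exact: unit_valued_bool.
have u0 v : 0 <= u v by have /andP[] := uI v.
pose G a (y z : 'I_N) : R := s y z * (col y z == a)%:R.
pose D a (y z : 'I_N) : R := s y z * x a.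
have GI a y : unit_valued (G a y) by apply: unit_valuedM => //; exact: unit_valued_bool.
have DI a y : unit_valued (D a y) by apply: unit_valuedM.
(* The weight [u] is absorbed into the test functions. *)
have cut a : cut_le (k * N%:R ^+ 2) u u (fun y z => G a y z - D a y z).
  move=> v v' vI v'I; have := hcol a _ _ (unit_valuedM uI vI) (unit_valuedM uI v'I).
  rewrite card_ord; apply: le_trans; rewrite le_eqVlt; apply/orP; left; apply/eqP.
  by congr `|_|; apply: eq_bigr => y _; apply: eq_bigr => z _; rewrite /G /D; ring.
have su : \sum_v u v <= N%:R.
  rewrite [leRHS](_ : _ = \sum_(v : 'I_N) 1); last by rewrite sumr_const card_ord.
  by apply: ler_sum => v _; have /andP[] := uI v.
pose Q (p : C * C * C) := \sum_a \sum_b \sum_c u a * u b * u c *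
  (G p.1.1 a b * G p.1.2 a c * G p.2 b c - D p.1.1 a b * D p.1.2 a c * D p.2 b c).
have QN p : `|Q p| <= 3 * k * N%:R ^+ 3.
  apply: le_trans (triangle_counting u0 u0 u0 (GI _) (GI _) (DI _) (DI _)
    (cut _) (cut _) (cut _)) _.
  rewrite [leRHS](_ : _ = k * N%:R ^+ 2 * (N%:R + N%:R + N%:R)); last by ring.
  rewrite ler_wpM2l ?mulr_ge0 ?(ltW k0) ?sqr_ge0 //; lra.
rewrite [X in 0 <= X + _](_ : _ = \sum_(p in T) Q p); last first.
  rewrite /Q; under [RHS]eq_bigr do rewrite !pair_bigA.
  rewrite [RHS]exchange_big !pair_bigA /=; apply: eq_bigr => -[[a b] c] _ /=.
  rewrite -mulr_sumr [LHS](_ : _ = u a * u b * u c * ((sorted3 val (a, b, c))%:R *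
    ((#|triple_set (a, b, c)| == 3)%:R * ((triple_set (a, b, c) \in
    palette_edges val col)%:R - palette_poly T x)))); last by rewrite /u /=; ring.
  congr (_ * _); rewrite sumrB.
  have [st|] := boolP (sorted3 _ _); last first.
    rewrite /sorted3 /= mul0r negb_and => ns; rewrite !big1 ?subrr // => p _.
      by rewrite /D /s; case/orP: ns => /negbTE ->; rewrite !(mul0r, mulr0).
    by rewrite /G /s; case/orP: ns => /negbTE ->; rewrite !(mul0r, mulr0).
  have /andP[/= ab bc] := st; have ac := ltn_trans ab bc.
  rewrite (card_triple_set val_inj st) eqxx !mul1r mem_palette_edges //; last exact: val_inj.
  congr (_ - _); last first.
    by apply: eq_bigr => p _; rewrite /D /s ab bc ac !mul1r.
  (* On a sorted triple the three class indicators single out the triple of its own colours. *)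
  rewrite (eq_bigr (fun p => (p == (col a b, col a c, col b c))%:R)); last first.
    case=> -[p1 p2] p3 _; rewrite /G /s ab bc ac !mul1r !xpair_eqE /= -!natrM !mulnb.
    by rewrite (eq_sym p1) (eq_sym p2) (eq_sym p3).
  have [qT|qT] := boolP (_ \in T).
    rewrite (bigD1 (col a b, col a c, col b c)) //= eqxx big1 ?addr0 //.
    by move=> p /andP[_ /negbTE ->].
  by rewrite big1 // => p pT; case: eqP => // E; rewrite -E pT in qT.
have : `|\sum_(p in T) Q p| <= eta * #|'I_N|%:R ^+ 3.
  rewrite card_ord; apply: le_trans (ler_norm_sum _ _ _) _.
  apply: le_trans (_ : 3 * k * #|T|%:R * N%:R ^+ 3 <= _).
    by rewrite mulrAC mulr_natr -sumr_const; apply: ler_sum.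
  by rewrite ler_wpM2r ?exprn_ge0.
by rewrite ler_norml => /andP[+ _]; rewrite -subr_ge0 opprK.
Qed.

End LowerBound.

(** A non-colourable 3-graph contains itself and colourability is hereditary, so the free 3-graphs
    are the colourable ones. The two density bounds then make the supremum a maximum. *)
Lemma pi_vvv_palette (R : realType) (C : finType) (T : {set C * C * C}) (x : C -> R) :
  simplex R C x ->
  (forall y, simplex R C y -> palette_poly T y <= palette_poly T x) ->
  pi_vvv R (fun H => ~ palette_colorable T H) = palette_poly T x.
Proof.
move=> xS xmax; set FF : Defs.family := fun H => _.
have freeE H : Defs.free FF H <-> palette_colorable T H.
  split=> [fH|cH F nF HF]; last by apply: nF; exact: palette_colorable_contains cH HF.
  apply: contrapT => nH; apply: (fH H nH); exists id; first exact: inj_id.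
  by move=> e; rewrite imset_id.
rewrite /pi_vvv; set S := (X in sup X).
have xin : S (palette_poly T x).
  split; first exact: palette_poly01.
  move=> eta n eta0; have [H [cH dH nH]] := palette_density_ge T xS n eta0.
  by exists H; split=> //; apply/freeE.
have ub : ubound S (palette_poly T x).
  move=> d [/andP[d0 _] hd]; apply: (palette_density_le xmax d0) => eta n eta0.
  by have [H [/freeE]] := hd eta n eta0; exists H.
apply/eqP; rewrite eq_le; apply/andP; split.
  by apply: ge_sup => //; exists (palette_poly T x).
by apply: ub_le_sup => //; exists (palette_poly T x).
Qed.

(** * The palette of a Lagrange polynomial *)

Section LagrangePalette.
Variables (V : finType) (E : {set {set V}}) (t : nat).

Definition orderings (e : {set V}) : {set V * V * V} := [set p | triple_set p == e]%SET.

(** The orderings kept are the first [t] in the enumeration; the monomial of a triple is the same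
    for all of them. *)
Definition lagrange_palette : {set V * V * V} :=
  [set p | (triple_set p \in E) && (p \in take t (enum (orderings (triple_set p))))]%SET.

(** This ensures that [take t] keeps exactly [t] orderings when [t <= 6]. *)
Lemma orderings_ge6 (e : {set V}) : #|e| = 3 -> (6 <= #|orderings e|)%N.
Proof.
move=> e3; have rI : injective (val \o @enum_rank V).
  by apply: inj_comp; [exact: val_inj | exact: enum_rank_inj].
have [[[u v] w] s ->] := triple_set_surj rI e3.
have := sorted3_uniq rI s; rewrite /= !inE negb_or andbT => /andP[/andP[uv uw] vw].
pose l := [:: (u, v, w); (u, w, v); (v, u, w); (v, w, u); (w, u, v); (w, v, u)].
have lu : uniq l.
  rewrite /l /= !inE !xpair_eqE !negb_or !negb_and ?eqxx (eq_sym v u) (eq_sym w u) (eq_sym w v).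
  by rewrite (negbTE uv) (negbTE uw) (negbTE vw).
rewrite -[6%N](card_uniqP lu); apply/subset_leq_card/fintype.subsetP => p pl.
rewrite inE; apply/eqP/setP => a; rewrite !inE.
by move: pl; rewrite !inE => /or4P[/eqP ->|/eqP ->|/eqP ->|/or3P[]/eqP ->] /=;
  case: (a == u); case: (a == v); case: (a == w).
Qed.

Lemma palette_poly_lagrange (R : realType) (x : V -> R) :
  E \subset ksubsets 3 [set: V]%SET -> (t <= 6)%N ->
  palette_poly lagrange_palette x = t%:R * \sum_(e in E) \prod_(i in e) x i.
Proof.
move=> E3 t6; rewrite /palette_poly (partition_big (@triple_set V) (mem E)) /=; last first.
  by move=> p; rewrite inE => /andP[].
rewrite mulr_sumr; apply: eq_bigr => e eE.
have e3 : #|e| = 3 by have := fintype.subsetP E3 _ eE; rewrite inE => /andP[_ /eqP].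
rewrite (eq_bigl (mem (take t (enum (orderings e))))); last first.
  move=> p; rewrite inE; apply/andP/idP => [[/andP[_ pt] /eqP <-] //|pt].
  have : p \in enum (orderings e) by exact: mem_take pt.
  by rewrite mem_enum inE => /eqP ->; rewrite eqxx eE.
rewrite (eq_bigr (fun=> \prod_(i in e) x i)); last first.
  move=> p /mem_take; rewrite mem_enum inE => /eqP pe.
  have u : uniq [:: p.1.1; p.1.2; p.2].
    apply/card_uniqP; rewrite /= -[RHS]e3 -pe; apply: eq_card => v; by rewrite !inE orbA.
  transitivity (\prod_(i <- [:: p.1.1; p.1.2; p.2]) x i).
    by rewrite !big_cons big_nil mulr1 mulrA.
  by rewrite big_uniq //; apply: eq_bigl => i; rewrite -pe !inE orbA.
rewrite -big_uniq ?take_uniq ?enum_uniq //= big_const_seq count_predT.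
rewrite size_takel ?iter_addr_0 ?mulr_natl // -cardE.
by apply: leq_trans t6 (orderings_ge6 e3).
Qed.

End LagrangePalette.

Local Open Scope classical_set_scope.
Local Open Scope ring_scope.

Theorem theorem1p2 (R : realType) (t : nat) (ht : (1 <= t <= 6)%N) :
  [set t%:R / 6 * l | l in Lambda3 R] `<=` Pi_vvv_infty R.
Proof.
move=> _ [_ [F ->] <-]; have /andP[t0 t6] := ht.
have [F0|F0] := posnP #|vert F|.
  (* Both values are [sup set0 = 0]: the simplex is empty, and no 3-graph avoids the family of all
     3-graphs. *)
  exists (fun=> True); rewrite [lagrangian R F](_ : _ = 0); last first.
    rewrite /lagrangian [X in sup X](_ : _ = set0) ?sup0 //.
    apply/seteqP; split=> // y [x [_ x1] _]; move: x1; rewrite big1 => [/eqP|v].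
      by rewrite eq_sym oner_eq0.
    by have := fintype0 v; rewrite F0 => /(_ erefl).
  rewrite mulr0 /pi_vvv [X in sup X](_ : _ = set0) ?sup0 //.
  apply/seteqP; split=> // d [_ /(_ 1 0%N ltr01)[H [fH _ _]]].
  apply: (fH H I); exists id; first exact: inj_id.
  by move=> e; rewrite imset_id.
have [x xS [xL Lmax]] := lagrangian_max R F0.
pose T := lagrange_palette (edges F) t.
have TL y : palette_poly T y = t%:R / 6 * lagrange_poly F y.
  rewrite palette_poly_lagrange ?edges_sub // /lagrange_poly mulrA; congr (_ * _).
  (* The factor [3!] of the Lagrange polynomial cancels the denominator [6]. *)
  by rewrite divfK // pnatr_eq0.
exists (fun H => ~ palette_colorable T H).
rewrite (pi_vvv_palette xS) ?TL ?xL // => y yS.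
by rewrite TL ler_wpM2l ?divr_ge0 // Lmax.
Qed.
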